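(* Let $n=2k+q\geq 2$ with integers $k,q\ge 0$, put $H_{k,q}=C_k\times S_q\le B_n$, and let $\lambda_{k,q}=\mathbf 1\boxtimes\mathrm{sgn}_{S_q}$. Then $(B_n,H_{k,q},\lambda_{k,q})$ is a linear Gelfand triple. If \[ b_{n,q}=\#\{(\alpha,\beta):|\alpha|+|\beta|=n,\ o_r(\alpha)+o_r(\beta)=q\} \] (ordered pairs of partitions), then $\mathscr A(B_n,H_{k,q},\lambda_{k,q})\cong\mathbb C^{b_{n,q}}$. In particular, $(B_{2k},C_k)$ is an ordinary Gelfand pair and \[ \mathscr A(B_{2k},C_k,\mathbf 1)\cong\mathbb C^{\sum_{i=0}^kp(i)p(k-i)} . \] The two characters $U_n=\mathrm{Ind}_{B_2\times S_{n-2}}^{B_n}(\mathbf 1\boxtimes\mathrm{sgn})$ and $\varepsilon U_n$ also define linear Gelfand triples (i.e. they are multiplicity-free).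
   Context: $B_n=N_n\rtimes S_n$ is the signed permutation group, $N_n=\langle f_1,\dots,f_n\rangle$ with $f_i$ changing the sign of coordinate $i$; $\varepsilon(w)=(-1)^{\#\{1\le i\le n:w(i)<0\}}$. On the first $2k$ coordinates put $a_i=(2i-1,2i)$, $c_i=f_{2i-1}f_{2i}$ ($1\le i\le k$), $b_i=(2i-1,2i+1)(2i,2i+2)$ ($1\le i<k$), $C_k=\langle a_i,c_i,b_i\rangle\cong(C_2\times C_2)\wr S_k\le B_{2k}$, $C_0=1$. $S_q$ permutes the last $q$ coordinates without signs; $B_2$ acts on the first two coordinates and $S_{n-2}$ permutes the remaining ones. $o_r(\alpha)$ is the number of odd parts of $\alpha$; $p(i)$ is the number of partitions of $i$, $p(0)=1$. For finite groups $H\le G$ and a linear complex character $\lambda$ of $H$, $(G,H,\lambda)$ is a linear Gelfand triple if $\mathrm{Ind}_H^G\lambda$ is multiplicity-free; if $\lambda=\mathbf 1$ one says $(G,H)$ is a Gelfand pair. $\mathscr A(G,H,\lambda)=e_\lambda\mathbb CGe_\lambda$, $e_\lambda=|H|^{-1}\sum_{h\in H}\lambda(h^{-1})h$. *)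

(* Defs.v *)
From HB Require Import structures.
From mathcomp Require Import all_boot all_order all_algebra.
From mathcomp Require Import all_fingroup all_solvable all_field all_character.

Set Implicit Arguments.
Unset Strict Implicit.
Unset Printing Implicit Defensive.

Import GRing.Theory Num.Theory GroupScope.
Local Open Scope ring_scope.

Definition multiplicity_free (gT : finGroupType) (G : {group gT})
    (phi : 'CF(G)) : Prop :=
  forall i : Iirr G, '[phi, 'chi_i] <= 1.

Definition linear_gelfand_triple (gT : finGroupType) (G H : {group gT})
    (lam : 'CF(H)) : Prop :=
  [/\ H \subset G, lam \is a linear_char & multiplicity_free ('Ind[G] lam)].

Definition gelfand_pair (gT : finGroupType) (G H : {group gT}) : Prop :=
  linear_gelfand_triple G (1 : 'CF(H)).

(* The group algebra CG is the library's group_ring C G, the span of the      *)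
(* matrices of the regular representation. Class functions have values in     *)
(* algC, the field of algebraic complex numbers; iota transports them to the  *)
(* field of scalars C, for instance C = algC or the field of all complex      *)
(* numbers.                                                                   *)
Definition hecke_idem (C : numClosedFieldType) (iota : {rmorphism algC -> C})
    (gT : finGroupType) (G H : {group gT}) (lam : 'CF(H)) : 'M[C]_#|G| :=
  (#|H|%:R)^-1 *: \sum_(h in H) iota (lam h^-1%g) *: regular_repr C G h.

Definition in_hecke (C : numClosedFieldType) (iota : {rmorphism algC -> C})
    (gT : finGroupType) (G H : {group gT}) (lam : 'CF(H)) (M : 'M[C]_#|G|)
    : Prop :=
  let e := hecke_idem iota G lam in
  exists2 x : 'M[C]_#|G|, (x \in group_ring C G)%MS & M = e *m x *m e.

(* There is a C-algebra isomorphism from C^b, with componentwise operations,  *)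
(* onto the Hecke algebra, whose unit is hecke_idem.                          *)
Definition hecke_iso_pow (C : numClosedFieldType)
    (iota : {rmorphism algC -> C}) (gT : finGroupType) (G H : {group gT})
    (lam : 'CF(H)) (b : nat) : Prop :=
  exists psi : {linear {ffun 'I_b -> C^o} -> 'M[C]_#|G|},
    [/\ injective psi,
        forall M, in_hecke iota lam M <-> exists v, psi v = M,
        forall u v, psi (u * v) = psi u *m psi v
      & psi 1 = hecke_idem iota G lam].

(* Signed permutations: coordinates are numbered from 0, and (i, false) and   *)
(* (i, true) stand for the signed points +(i+1) and -(i+1).                   *)

Definition spoint (n : nat) : finType := ('I_n * bool)%type.

Definition spoint_opp n (x : spoint n) : spoint n := (x.1, ~~ x.2).

Lemma spoint_opp_inj n : injective (@spoint_opp n).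
Proof. by move=> [i a] [j b] [-> /negb_inj ->]. Qed.

Definition minus n : {perm spoint n} := perm (@spoint_opp_inj n).

(* The permutations w of the signed points such that w (- x) = - w x. Here    *)
(* (u * v) x = v (u x); inversion exchanges this with the opposite convention *)
(* and preserves all the subgroups and the (real) characters below.           *)
Definition B (n : nat) : {group {perm spoint n}} := 'C[minus n]%G.

Lemma in_B n (w : {perm spoint n}) :
  reflect (forall x, w (spoint_opp x) = spoint_opp (w x)) (w \in B n).
Proof.
apply: (iffP cent1P) => [cw x | cw].
  by have /permP/(_ x) := cw; rewrite !permM !permE.
by apply/permP=> x; rewrite !permM !permE cw.
Qed.

Definition neg_count n (w : {perm spoint n}) : nat :=
  #|[set i : 'I_n | (w (i, false)).2]|.

Lemma neg_countM n : {in B n &, forall u v,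
  odd (neg_count (u * v)%g) = odd (neg_count u) (+) odd (neg_count v)}.
Proof.
have oddE w : odd (neg_count w) = \big[addb/false]_(i < n) (w (i, false)).2.
  rewrite /neg_count -sum1dep_card big_mkcond /=.
  by elim/big_rec2: _ => // i b m _ <-; rewrite oddD; case: (_.2).
move=> u v uB vB; rewrite !oddE.
have uE i b : u (i, b) = ((u (i, false)).1, (u (i, false)).2 (+) b).
  case: b; last by rewrite addbF -surjective_pairing.
  by rewrite -[(i, true)]/(spoint_opp (i, false)) (in_B _ uB) /spoint_opp addbT.
have vE x : (v x).2 = (v (x.1, false)).2 (+) x.2.
  case: x => i []; last by rewrite addbF.
  by rewrite -[(i, true)]/(spoint_opp (i, false)) (in_B _ vB) /= addbT.
have inj_u : injective (fun i => (u (i, false)).1).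
  move=> i j eq_ij.
  have: u (i, false) = u (j, (u (i, false)).2 (+) (u (j, false)).2).
    rewrite [u (j, _)]uE -eq_ij addbC -addbA addbb addbF.
    exact: surjective_pairing.
  by move/perm_inj/(congr1 fst).
rewrite [X in _ = _ (+) X](reindex_inj inj_u) -big_split.
by apply: eq_bigr => i _; rewrite permM vE addbC.
Qed.

Fact cfeps_subproof n : is_class_fun <<B n>>
  [ffun w => (-1) ^+ neg_count w *+ (w \in B n)].
Proof.
rewrite genGid; apply: intro_class_fun => [x y xB yB | x /negbTE-> //].
rewrite groupJ // xB; congr (_ *+ _); rewrite -signr_odd -[RHS]signr_odd.
have [yV xy] := (groupVr yB, groupM xB yB).
rewrite conjgE neg_countM // neg_countM //; congr (_ ^+ nat_of_bool _).
have: odd (neg_count (y^-1 * y)%g) = false.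
  by rewrite mulVg /neg_count eq_card0 // => i; rewrite inE perm1.
by rewrite neg_countM //; do 3![case: (odd _)].
Qed.
Definition cfeps n : 'CF(B n) := Cfun 0 (cfeps_subproof n).

Lemma sperm_inj n (s : {perm 'I_n}) :
  injective (fun x : spoint n => (s x.1, x.2) : spoint n).
Proof. by move=> [i a] [j b] [/perm_inj-> ->]. Qed.

Definition sperm n (s : {perm 'I_n}) : {perm spoint n} := perm (@sperm_inj n s).

Lemma spermM n :
  {in [set: {perm 'I_n}] &, {morph @sperm n : s t / (s * t)%g}}.
Proof. by move=> s t _ _; apply/permP=> x; rewrite !(permE, permM). Qed.
Canonical sperm_morphism n := Morphism (@spermM n).

Definition swap n (i j : 'I_n) : {perm spoint n} := sperm (tperm i j).
Definition flip n (i : 'I_n) : {perm spoint n} := tperm (i, false) (i, true).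

(* The pairs of 0-based coordinates (2i, 2i+1), i < k. *)
Definition blocks (n k : nat) : {set 'I_n * 'I_n} :=
  [set p : 'I_n * 'I_n |
    [&& ~~ odd p.1, p.2 == p.1.+1 :> nat & (p.2 < 2 * k)%N]].

(* The three sets of generators are the a_i, the c_i and the b_i.             *)
Definition Ck (n k : nat) : {group {perm spoint n}} :=
  <<[set swap p.1 p.2 | p in blocks n k]
    :|: [set (flip p.1 * flip p.2)%g | p in blocks n k]
    :|: [set (swap p.1 r.1 * swap p.2 r.2)%g
          | p in blocks n k, r in blocks n k & r.1 == p.2.+1 :> nat]>>%G.

(* The copy of B_m acting on the first m coordinates. *)
Definition Bhead (n m : nat) : {group {perm spoint n}} :=
  'C_(B n)([set x : spoint n | (m <= x.1)%N] | 'P)%G.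

(* The symmetric group permuting without signs the coordinates from the m-th  *)
(* (0-based) on, i.e. the last n - m ones.                                    *)
Definition tailset (n m : nat) : {set 'I_n} := [set i : 'I_n | (m <= i)%N].

Definition Stail (n m : nat) : {group {perm spoint n}} :=
  (@sperm n @* perm.Sym (tailset n m))%G.

Fact cfsgn_subproof (T : finType) (G : {group {perm T}}) :
  is_class_fun <<G>> [ffun s => (-1) ^+ odd_perm s *+ (s \in G)].
Proof.
rewrite genGid; apply: intro_class_fun => [x y xG yG | x /negbTE-> //].
by rewrite groupJ // xG odd_permJ.
Qed.
Definition cfsgn (T : finType) (G : {group {perm T}}) : 'CF(G) :=
  Cfun 0 (cfsgn_subproof G).

Fact Stail_isom n m :
  isom (perm.Sym (tailset n m)) (Stail n m)
       (restrm (subsetT (perm.Sym (tailset n m))) (@sperm n)).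
Proof.
apply/isomP; split; last by rewrite morphim_restrm setIid.
apply/injmP=> s t _ _ /permP eq_st; apply/permP=> i.
by have /= := congr1 fst (eq_st (i, false)); rewrite !permE.
Qed.

(* The sign character of the symmetric group Stail; it is NOT the sign of the *)
(* permutations of the signed points, which is trivial on Stail.              *)
Definition cfsgn_tail (n m : nat) : 'CF(Stail n m) :=
  cfIsom (Stail_isom n m) (cfsgn [group of perm.Sym (tailset n m)]).

Definition headpts (n m : nat) : {set spoint n} :=
  [set x : spoint n | (x.1 < m)%N].

Lemma Ck_sub_Sym n k : Ck n k \subset perm.Sym (headpts n (2 * k)).
Proof.
have swapS (i j : 'I_n) : (i < 2 * k)%N -> (j < 2 * k)%N ->
    @swap n i j \in perm.Sym (headpts n (2 * k)).
  move=> lti ltj; rewrite inE; apply/subsetP=> x; rewrite !inE.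
  apply: contraR => ltx; apply/eqP; rewrite permE.
  by rewrite tpermD -?surjective_pairing //; apply: contraNneq ltx => <-.
have flipS (i : 'I_n) : (i < 2 * k)%N -> @flip n i \in perm.Sym (headpts n (2 * k)).
  move=> lti; rewrite inE; apply/subsetP=> x; rewrite !inE.
  apply: contraR => ltx; apply/eqP.
  by rewrite tpermD //; apply: contraNneq ltx => <-.
have blt p : p \in blocks n k -> (p.1 < 2 * k)%N /\ (p.2 < 2 * k)%N.
  by rewrite inE => /and3P[_ /eqP p2 lt2]; split=> //; rewrite (ltn_trans _ lt2) ?p2.
rewrite gen_subG !subUset -andbA; apply/and3P; split; apply/subsetP=> w.
- by case/imsetP=> p /blt[lt1 lt2] ->; apply: swapS.
- by case/imsetP=> p /blt[lt1 lt2] ->; rewrite groupM ?flipS.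
case/imset2P=> p r /blt[lt1 lt2]; rewrite inE => /andP[/blt[lr1 lr2] _] ->.
by rewrite groupM ?swapS.
Qed.

Lemma Bhead_sub_Sym n m : Bhead n m \subset perm.Sym (headpts n m).
Proof.
apply/subsetP=> w; rewrite 2!inE => /andP[_ /astabP fw].
rewrite inE; apply/subsetP=> x; rewrite !inE; apply: contraR => lex.
by apply/eqP; apply: fw; rewrite inE leqNgt.
Qed.

Lemma Stail_sub_Sym n m : Stail n m \subset perm.Sym (~: headpts n m).
Proof.
apply/subsetP=> _ /morphimP[s _ Ss ->]; rewrite inE; apply/subsetP=> x.
rewrite !inE -leqNgt; apply: contraR => ltx; apply/eqP; rewrite permE.
rewrite inE in Ss; rewrite (out_perm Ss) -?surjective_pairing //.
by rewrite inE.
Qed.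

Lemma dprod_Sym (T : finType) (S : {set T}) (K L : {group {perm T}}) :
  K \subset perm.Sym S -> L \subset perm.Sym (~: S) -> K \x L = K <*> L.
Proof.
move=> /subsetP KS /subsetP LS; apply: dprodEY.
  apply/subsetP=> y /LS; rewrite inE => yS; apply/centP=> x /KS.
  rewrite inE => xS; apply/esym; apply: (perm_onC xS yS).
  by rewrite disjoints_subset setCK.
apply/trivgP/subsetP=> x; rewrite inE => /andP[/KS + /LS].
rewrite !inE => xS xS'; apply/eqP/permP=> z; rewrite perm1.
have [zS | zS] := boolP (z \in S); last exact: (out_perm xS).
by apply: (out_perm xS'); rewrite inE zS.
Qed.

(* H_(k,q) in B_n, where q = n - 2k is left implicit.                         *)
Definition Hk (n k : nat) : {group {perm spoint n}} :=
  (Ck n k <*> Stail n (2 * k))%G.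

Fact Hk_dprod n k : Ck n k \x Stail n (2 * k) = Hk n k.
Proof. exact: dprod_Sym (Ck_sub_Sym n k)
  (Stail_sub_Sym n (2 * k)). Qed.

Definition lambdak (n k : nat) : 'CF(Hk n k) :=
  cfDprod (Hk_dprod n k) 1 (cfsgn_tail n (2 * k)).

Definition B2S (n : nat) : {group {perm spoint n}} :=
  (Bhead n 2 <*> Stail n 2)%G.

Fact B2S_dprod n : Bhead n 2 \x Stail n 2 = B2S n.
Proof. exact: dprod_Sym (Bhead_sub_Sym n 2) (Stail_sub_Sym n 2). Qed.

Definition lambda2 (n : nat) : 'CF(B2S n) :=
  cfDprod (B2S_dprod n) 1 (cfsgn_tail n 2).

Definition U (n : nat) : 'CF(B n) := 'Ind[B n] (lambda2 n).

Definition is_part (s : seq nat) : bool := sorted geq s && (0%N \notin s).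

Definition odd_parts (s : seq nat) : nat := count odd s.

(* A partition of m <= N has at most N parts, all at most N, so the           *)
(* partitions of the integers up to N are among the values of parts N.        *)
Definition bseqN (N : nat) : finType := N.-bseq 'I_N.+1.
Definition parts (N : nat) (s : bseqN N) : seq nat := [seq val i | i <- s].

Lemma partsP (N : nat) (s : seq nat) : is_part s -> (sumn s <= N)%N ->
  exists t : bseqN N, parts t = s.
Proof.
case/andP=> _ s0 leN.
have le_sum x : x \in s -> (x <= sumn s)%N.
  move=> xs; rewrite sumnE (big_rem x) //=; exact: leq_addr.
have szs : (size s <= N)%N.
  apply: leq_trans leN; elim: s s0 {le_sum} => //= x s IHs.
  rewrite inE negb_or eq_sym => /andP[x0 /IHs le_s].
  by rewrite -add1n leq_add // lt0n.
pose t : seq 'I_N.+1 := [seq inord i | i <- s].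
have szt : (size t <= N)%N by rewrite size_map.
exists (Bseq szt); rewrite /parts /= -map_comp -[RHS]map_id.
apply/eq_in_map => i si /=; rewrite inordK // ltnS.
exact: leq_trans (le_sum i si) leN.
Qed.

Definition num_part (m : nat) : nat :=
  #|[set s : bseqN m | is_part (parts s) && (sumn (parts s) == m)]|.

Definition num_bipart (n q : nat) : nat :=
  #|[set ab : bseqN n * bseqN n |
      [&& is_part (parts ab.1), is_part (parts ab.2),
          (sumn (parts ab.1) + sumn (parts ab.2) == n)%N
        & (odd_parts (parts ab.1) + odd_parts (parts ab.2) == q)%N]]|.

(* Main.v *)
Require Import Defs.
From HB Require Import structures.
From mathcomp Require Import all_boot all_order all_algebra.
From mathcomp Require Import all_fingroup all_solvable all_field all_character.
From mathcomp Require Import zify.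

(* A coset of H = H_(k,q) in B_n is a signed partial matching of the points 1 *)
(* .. n with k edges and a sign on each of the q unmatched points, so double  *)
(* cosets are isomorphism classes of pairs of signed matchings. Up to sign    *)
(* switching such a pair is a disjoint union of alternating cycles (an even   *)
(* number of points) and paths, each carrying a sign. A path with both ends   *)
(* unmatched in the same matching can be reversed by an element of H whose    *)
(* sign is -1 for one matching and 1 for the other, so it cannot occur in a   *)
(* double coset supporting a Hecke operator. Conversely, if all paths have an *)
(* odd number of points, the two sets of unmatched points are in equivariant  *)
(* bijection and the double coset does support one. The relevant double       *)
(* cosets thus correspond to pairs of partitions of total size n (components  *)
(* of sign +, components of sign -) with q odd parts in all. Each of these    *)
(* pairs of matchings is exchanged by an involution of B_n lying in the       *)
(* double coset, so e R(g) e is a symmetric matrix for all g, R being the     *)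
(* regular representation: the Hecke algebra is commutative, which makes the  *)
(* induced character multiplicity-free. The number of its constituents is its *)
(* norm, the number of relevant double cosets, and the products of e with the *)
(* central idempotents of these constituents are a basis of the Hecke algebra *)
(* formed by orthogonal idempotents. Finally, U_n is multiplicity-free since  *)
(* 1 x sgn on B_2 x S_(n-2) is a constituent of the character induced from    *)
(* C_1 x S_(n-2).                                                             *)

Set Implicit Arguments.
Unset Strict Implicit.
Unset Printing Implicit Defensive.

Import GRing.Theory Num.Theory.
Local Open Scope ring_scope.

(** * Gelfand's trick for linear characters *)

(** The general half concerns a linear character [lam] of H. Mackey's formula makes the norm of the
    induced character the number of admissible double cosets ([cfnorm_Ind_card]). Symmetric matrices
    whose products are again symmetric commute ([corner_comm]); an idempotent of a full matrix
    algebra with a commutative corner has trace 0 or 1 ([comm_corner_tr3]), and this trace is the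
    multiplicity of an irreducible ([tr_hecke_idem]). [gelfand_count] collects these facts.

    In the combinatorial half, [Hk] is the full stabilizer of one signed matching ([Hk_stab]) and
    [lambdak] is the sign of its action on the positive unmatched points ([lambdakE]), so double
    cosets become isomorphism classes of [matching_pair]. By [half_turn] and [far_end], admissible
    means [good]; [classification] cuts good pairs into standard blocks, [std_iso_perm] shows that
    the blocks are determined, and [std_swap] supplies the involution. *)

Section DoubleCosets.
Variables (gT : finGroupType) (G H : {group gT}) (lam : 'CF(H)).

(* The g such that the double coset of g supports a nonzero element of the    *)
(* Hecke algebra.                                                             *)
Definition admissible (g : gT) : bool :=
  [forall h in H, ((h ^ g)%g \in H) ==> (lam (h ^ g)%g == lam h)].

Lemma admissibleP g :
  reflect {in H, forall h, (h ^ g)%g \in H -> lam (h ^ g)%g = lam h}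
          (admissible g).
Proof.
apply: (iffP forall_inP) => adm h hH; last by apply/implyP=> /(adm _ hH)/eqP.
by move/implyP: (adm h hH) => /[apply] /eqP.
Qed.

Hypothesis lin : lam \is a linear_char.

Let sect (g : gT) : {group gT} := (H :&: H :^ g^-1)%G.

Lemma mem_sect g h : (h \in sect g) = (h \in H) && ((h ^ g)%g \in H).
Proof. by rewrite inE mem_conjg invgK. Qed.

(** On the group [sect g], sending h to [lam (h ^ g) * (lam h)^*] is a linear character, trivial
    exactly when g is admissible; a nontrivial one sums to 0. Terms outside [sect g] vanish. *)
Lemma dcoset_sumE g :
  \sum_(h in H) lam (h ^ g)%g * (lam h)^* =
    if admissible g then #|sect g|%:R else 0.
Proof.
have vanish h : h \in H -> (h ^ g)%g \notin H -> lam (h ^ g)%g * (lam h)^* = 0.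
  by move=> _ hgH; rewrite (cfun0 _ hgH) mul0r.
rewrite (bigID (fun h => (h ^ g)%g \in H)) /= [X in _ + X]big1 ?addr0; last first.
  by move=> h /andP[]; apply: vanish.
rewrite (eq_bigl _ _ (fun h => esym (mem_sect g h))).
case: admissibleP => [adm | nadm].
  rewrite -sumr_const; apply: eq_bigr => h; rewrite mem_sect => /andP[hH hgH].
  by rewrite adm // -normCK normC_lin_char // expr1n.
have [h0 h0K neq] : exists2 h, h \in sect g & lam (h ^ g)%g != lam h.
  apply/exists_inP; apply: contra_notT nadm; rewrite negb_exists_in => /forall_inP nx h hH hgH.
  by apply/eqP/negPn/nx; rewrite mem_sect hH.
have := h0K; rewrite mem_sect => /andP[h0H h0gH].
pose S := \sum_(h in sect g) lam (h ^ g)%g * (lam h)^*.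
have S_eq : lam (h0 ^ g)%g * (lam h0)^* * S = S.
  rewrite mulr_sumr /S [RHS](reindex_inj (mulIg h0)) /=.
  rewrite [RHS](eq_bigl (fun h => h \in sect g)) => [|h]; last exact: groupMr.
  apply: eq_bigr => h; rewrite mem_sect => /andP[hH hgH].
  rewrite conjMg (lin_charM lin hgH h0gH) (lin_charM lin hH h0H) rmorphM.
  by rewrite mulrACA [X in X * _ = _]mulrC [X in _ * X = _]mulrC.
have : (lam (h0 ^ g)%g * (lam h0)^* - 1) * S = 0 by rewrite mulrBl S_eq mul1r subrr.
move/eqP; rewrite mulf_eq0 subr_eq0 => /orP[/eqP one|/eqP//].
have norm1 : lam h0 * (lam h0)^* = 1 by rewrite -normCK normC_lin_char ?expr1n.
by case/eqP: neq; rewrite -[LHS]mulr1 -norm1 mulrCA one mulr1.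
Qed.

Hypothesis sHG : H \subset G.

(** Frobenius reciprocity and an exchange of sums: Mackey's formula as a sum over group elements,
    which avoids choosing representatives. *)
Lemma cfnorm_Ind_admissible :
  '['Ind[G] lam] = (#|H|%:R ^- 2) * \sum_(g in G | admissible g) #|sect g|%:R.
Proof.
rewrite -cfdot_Res_l cfdotE.
transitivity (#|H|%:R^-1 * \sum_(h in H) \sum_(g in G)
    #|H|%:R^-1 * (lam (h ^ g)%g * (lam h)^*)).
  congr (_ * _); apply: eq_bigr => h hH.
  by rewrite cfResE // cfIndE // -mulrA mulr_suml mulr_sumr.
rewrite exchange_big /= expr2 invfM -mulrA; congr (_ * _).
rewrite mulr_sumr [in RHS]big_mkcondr /=; apply: eq_bigr => g gG.
by rewrite -mulr_sumr dcoset_sumE; case: ifP => // _; rewrite mulr0.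
Qed.

Definition dcoset (g : gT) : {set gT} := (H :* g * H)%g.

Lemma dcosetP g x :
  reflect (exists2 h, h \in H & exists2 k, k \in H & x = (h * g * k)%g)
          (x \in dcoset g).
Proof.
apply: (iffP mulsgP) => [[_ k /rcosetP[h hH ->] kH ->] | [h hH [k kH ->]]].
  by exists h => //; exists k.
by exists (h * g)%g k; rewrite ?mem_rcoset ?mulgK.
Qed.

Lemma dcoset_refl g : g \in dcoset g.
Proof. by apply/dcosetP; exists 1%g => //; exists 1%g; rewrite ?mul1g ?mulg1. Qed.

Lemma dcoset_sym g x : x \in dcoset g -> g \in dcoset x.
Proof.
case/dcosetP=> h hH [k kH ->]; apply/dcosetP; exists h^-1%g; rewrite ?groupV //.
by exists k^-1%g; rewrite ?groupV // !mulgA mulVg mul1g mulgK.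
Qed.

Lemma dcoset_trans g x y : x \in dcoset g -> y \in dcoset x -> y \in dcoset g.
Proof.
case/dcosetP=> h hH [k kH ->] /dcosetP[h' h'H [k' k'H ->]]; apply/dcosetP.
by exists (h' * h)%g; rewrite ?groupM //; exists (k * k')%g; rewrite ?groupM ?mulgA.
Qed.

Lemma dcoset_admissible g x : x \in dcoset g -> admissible g -> admissible x.
Proof.
case/dcosetP=> h hH [k kH ->] /admissibleP adm; apply/admissibleP=> l lH.
rewrite !conjgM groupJr // => lgH; rewrite cfunJ //.
by rewrite (adm _ (groupJ lH hH) lgH) cfunJ.
Qed.

(** Translation by g^-1 turns H g H into the product of H and a conjugate, whose intersection is
    [sect g]. *)
Lemma card_dcoset g : (#|dcoset g| * #|sect g| = #|H| ^ 2)%N.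
Proof.
have -> : (#|H| ^ 2 = #|H| * #|(H :^ g^-1)%g|)%N by rewrite cardJg expnS expn1.
rewrite (mul_cardG H (H :^ g^-1)%G) -(card_rcoset (dcoset g) g^-1).
by rewrite /dcoset /= conjsgE invgK !mulgA.
Qed.

Section Representatives.
Variables (I : finType) (A : {set I}) (w : I -> gT).
Hypothesis wG : {in A, forall a, w a \in G}.
Hypothesis w_adm : {in A, forall a, admissible (w a)}.
Hypothesis w_cover : {in G, forall g, admissible g ->
  exists2 a, a \in A & g \in dcoset (w a)}.
Hypothesis w_inj : {in A &, forall a b, w b \in dcoset (w a) -> a = b}.

(** All elements of a double coset contribute the same [#|sect g|], so by [card_dcoset] an
    admissible double coset contributes [#|H| ^ 2] before division, that is, 1. *)
Lemma cfnorm_Ind_card : '['Ind[G] lam] = #|A|%:R.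
Proof.
rewrite cfnorm_Ind_admissible.
transitivity (#|H|%:R ^- 2 * (\sum_(g : gT)
    \sum_(a in A | g \in dcoset (w a)) #|sect g|%:R) : algC).
  congr (_ * _); rewrite big_mkcond /=; apply: eq_bigr => g _.
  case: ifP => [/andP[gG /(w_cover gG)[a aA ga]] | notadm].
    rewrite (big_pred1 a) // => b /=; apply/andP/eqP=> [[bA gb]|->] //.
    by apply: w_inj => //; apply: dcoset_trans gb (dcoset_sym ga).
  rewrite big1 // => a /andP[aA ga]; case/negP: notadm.
  rewrite (dcoset_admissible ga) ?w_adm // andbT.
  by case/dcosetP: ga => h hH [k kH ->]; rewrite !groupM ?wG // (subsetP sHG).
rewrite (exchange_big_dep (mem A)) /= => [|g a _ /andP[] //].
rewrite -[RHS]sumr_const mulr_sumr; apply: eq_bigr => a aA.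
rewrite (eq_bigl (mem (dcoset (w a)))) => [|g]; last by rewrite aA.
have sectE g : g \in dcoset (w a) -> #|sect g| = #|sect (w a)|.
  move=> ga; have eqd : dcoset g = dcoset (w a).
    apply/setP=> x; apply/idP/idP; first exact: dcoset_trans.
    exact/dcoset_trans/dcoset_sym.
  have gt0 : (0 < #|dcoset g|)%N by apply/card_gt0P; exists g; exact: dcoset_refl.
  apply/eqP; rewrite -(eqn_pmul2l gt0); apply/eqP.
  by rewrite [LHS]card_dcoset eqd [RHS]card_dcoset.
rewrite (eq_bigr (fun=> #|sect (w a)|%:R)) => [|g /sectE-> //].
rewrite sumr_const -mulrnA mulnC card_dcoset -natrX mulVf //.
by rewrite natrX expf_neq0 ?neq0CG.
Qed.

End Representatives.
End DoubleCosets.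

(** * Idempotents with a commutative corner *)

Section RankOneIdempotent.
Variables (R : numDomainType) (n : nat) (E : 'M[R]_n).
Hypothesis idemE : E *m E = E.
Hypothesis commE : forall A B : 'M[R]_n,
  E *m A *m E *m B *m E = E *m B *m E *m A *m E.

(* Commutation with A = delta_(i,j) and B = delta_(k,l), summed over j = k. *)
Lemma comm_corner_entries a i l b : E a i * \tr E * E l b = E a b * E l i.
Proof.
have entry A j k c d : (A *m delta_mx j k : 'M_n) c d = A c j *+ (d == k).
  move=> /=; rewrite mxE (bigD1 j) //= mxE eqxx big1 ?addr0 => [|x /negbTE xj].
    by case: eqP => _; rewrite ?mulr1 ?mulr0.
  by rewrite mxE xj mulr0.
have entry3 j k j' k' c d :
    (E *m delta_mx j k *m E *m delta_mx j' k' *m E) c d = E c j * E k j' * E k' d.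
  rewrite mxE (bigD1 k') //= entry eqxx mulr1n big1 ?addr0 => [|x /negbTE xk].
    congr (_ * _); rewrite mxE (bigD1 k) //= entry eqxx mulr1n big1 ?addr0 // => x /negbTE xk.
    by rewrite entry xk mul0r.
  by rewrite entry xk mul0r.
have swap j k : E a i * E j k * E l b = E a k * E l i * E j b.
  by have /matrixP/(_ a b) := commE (delta_mx i j) (delta_mx k l); rewrite !entry3.
have /matrixP/(_ a b) := idemE; rewrite mxE => <-.
rewrite /mxtrace mulr_sumr !mulr_suml; apply: eq_bigr => j _.
by rewrite swap mulrAC.
Qed.

(** Taking a = i and l = b in [comm_corner_entries] and summing over i and b gives tr(E)^3 =
    tr(E^2). *)
Lemma comm_corner_tr3 : \tr E ^+ 3 = \tr E.
Proof.
transitivity (\sum_i \sum_j E i i * \tr E * E j j).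
  rewrite exprSr expr2 [X in X * _ * _ = _]/mxtrace !mulr_suml.
  by apply: eq_bigr => i _; rewrite mulr_sumr.
rewrite -[in RHS]idemE; apply: eq_bigr => i _; rewrite mxE.
by apply: eq_bigr => j _; rewrite comm_corner_entries.
Qed.

(** With trace 1, [comm_corner_entries] reads E_ai E_lb = E_ab E_li: E has rank one. *)
Lemma comm_corner_scale A : \tr E = 1 -> E *m A *m E = \tr (E *m A) *: E.
Proof.
move=> tr1; apply/matrixP=> a b; rewrite !mxE.
transitivity (\sum_l \sum_i E a b * (E l i * A i l)).
  apply: eq_bigr => l _; rewrite mxE mulr_suml; apply: eq_bigr => i _.
  by rewrite mulrA -comm_corner_entries tr1 mulr1 mulrAC.
rewrite /mxtrace mulr_suml; apply: eq_bigr => l _.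
by rewrite -mulr_sumr mulrC mxE.
Qed.

End RankOneIdempotent.

Lemma trmx_regular (R : fieldType) (gT : finGroupType) (G : {group gT}) g :
  g \in G -> (regular_repr R G g)^T = regular_repr R G g^-1%g.
Proof.
move=> gG; apply/matrixP=> i j; rewrite !mxE !eqxx /=.
have valG (k : 'I_#|G|) : enum_val k \in G := enum_valP k.
congr (nat_of_bool _)%:R.
apply/eqP/eqP=> [-> | ->]; rewrite gring_indexK ?groupM ?groupV // ?mulgK ?mulgKV;
  by rewrite gring_valK.
Qed.

(** * Commutativity of the Hecke algebra and its orthogonal idempotents *)

Section GelfandTrick.
Variables (gT : finGroupType) (G H : {group gT}) (lam : 'CF(H)).
Hypothesis sHG : H \subset G.
Hypothesis lin : lam \is a linear_char.
Hypothesis lam_real : {in H, forall h, lam h^-1%g = lam h}.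
Hypothesis adm_inv : {in G, forall g, admissible lam g ->
  exists2 h, h \in H & ((h * g) * (h * g) = 1)%g}.

Local Notation aG := (regular_repr algC G).
Local Notation R_G := (group_ring algC G).
Local Notation e := (hecke_idem (idfun : {rmorphism algC -> algC}) G lam).

Let inG h : h \in H -> h \in G. Proof. exact: (subsetP sHG). Qed.

Lemma hecke_idem_mull h : h \in H -> aG h *m e = lam h *: e.
Proof.
move=> hH; rewrite /hecke_idem -scalemxAr scalerA mulrC -scalerA; congr (_ *: _).
rewrite mulmx_sumr scaler_sumr [RHS](reindex_inj (mulgI h)) /=.
rewrite [RHS](eq_bigl (mem H)) => [|k]; last by rewrite groupMl.
apply: eq_bigr => k kH; rewrite -scalemxAr -repr_mxM ?inG // scalerA; congr (_ *: _).
by rewrite /= invMg (lin_charM lin) ?groupV // mulrCA (lin_charV lin hH) divff ?mulr1 ?lin_char_neq0.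
Qed.

Lemma hecke_idem_mulr h : h \in H -> e *m aG h = lam h *: e.
Proof.
move=> hH; rewrite /hecke_idem -scalemxAl scalerA mulrC -scalerA; congr (_ *: _).
rewrite mulmx_suml scaler_sumr [RHS](reindex_inj (mulIg h)) /=.
rewrite [RHS](eq_bigl (mem H)) => [|k]; last by rewrite groupMr.
apply: eq_bigr => k kH; rewrite -scalemxAl -repr_mxM ?inG // scalerA; congr (_ *: _).
by rewrite /= invMg (lin_charM lin) ?groupV // mulrA (lin_charV lin hH) divff ?mul1r ?lin_char_neq0.
Qed.

Lemma hecke_idemK : e *m e = e.
Proof.
rewrite {1}/hecke_idem -scalemxAl mulmx_suml.
rewrite (eq_bigr (fun=> e)) => [|h hH]; last first.
  rewrite -scalemxAl hecke_idem_mull // scalerA /= lin_charV //.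
  by rewrite mulVf ?scale1r ?lin_char_neq0.
by rewrite sumr_const -scaler_nat scalerA mulVf ?scale1r // neq0CG.
Qed.

Lemma hecke_idem_mem : (e \in R_G)%MS.
Proof.
rewrite /hecke_idem linearZ scalemx_sub // linear_sum summx_sub // => h hH.
by rewrite linearZ scalemx_sub // envelop_mx_id ?inG.
Qed.

Lemma trmx_hecke_idem : e^T = e.
Proof.
rewrite /hecke_idem linearZ linear_sum /=; congr (_ *: _).
rewrite [RHS](reindex_inj invg_inj) /=.
rewrite [RHS](eq_bigl (mem H)) => [|k]; last by rewrite groupV.
by apply: eq_bigr => h hH; rewrite linearZ /= trmx_regular ?inG // invgK lam_real.
Qed.

(** Since [h * g = g * (h ^ g)], absorbing h or [h ^ g] into e scales the same corner by [lam h] or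
    by [lam (h ^ g)], and these differ for some h. *)
Lemma corner_not_admissible g :
  g \in G -> ~~ admissible lam g -> e *m aG g *m e = 0.
Proof.
move=> gG; rewrite negb_forall_in => /exists_inP[h hH].
rewrite negb_imply => /andP[hgH neq].
have : e *m aG g *m (aG (h ^ g)%g *m e) = e *m aG h *m aG g *m e.
  rewrite mulmxA; congr (_ *m e); rewrite -!mulmxA; congr (e *m _).
  by rewrite -(repr_mxM _ gG (inG hgH)) -conjgC (repr_mxM _ (inG hH) gG).
rewrite (hecke_idem_mull hgH) (hecke_idem_mulr hH). rewrite -scalemxAr -!scalemxAl.
move/eqP; rewrite -subr_eq0 -scalerBl scaler_eq0 subr_eq0 (negbTE neq) /=.
by move/eqP.
Qed.

(** An element [h * g] of square 1 has a symmetric regular matrix, and replacing g by [h * g] only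
    scales the corner. *)
Lemma corner_symmetric g : g \in G -> (e *m aG g *m e)^T = e *m aG g *m e.
Proof.
move=> gG; have [/(adm_inv gG)[h hH hg2] | /(corner_not_admissible gG)->] := boolP (admissible lam g);
  last by rewrite trmx0.
have hgG : (h * g)%g \in G by apply: groupM; rewrite ?gG ?(inG hH).
have eqhg : e *m aG (h * g)%g *m e = lam h *: (e *m aG g *m e).
  by rewrite (repr_mxM _ (inG hH) gG) mulmxA (hecke_idem_mulr hH) -!scalemxAl.
apply: (scalerI (lin_char_neq0 lin hH)); rewrite -linearZ /= -eqhg.
rewrite !trmx_mul trmx_regular // trmx_hecke_idem mulmxA.
by rewrite -[(h * g)%g in RHS](mulgK (h * g)%g) hg2 mul1g.
Qed.

(** A product of two corners is a combination of corners, hence symmetric; transposing it reverses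
    the factors. *)
Lemma corner_comm x y : x \in G -> y \in G ->
  e *m aG x *m e *m aG y *m e = e *m aG y *m e *m aG x *m e.
Proof.
move=> xG yG.
have split2 u v : u \in G -> v \in G ->
    e *m aG u *m e *m aG v *m e = (e *m aG u *m e) *m (e *m aG v *m e).
  by move=> uG vG; rewrite !mulmxA -[e *m aG u *m e *m e]mulmxA hecke_idemK.
suffices sym : (e *m aG x *m e *m aG y *m e)^T = e *m aG x *m e *m aG y *m e.
  by rewrite -[LHS]sym split2 // trmx_mul !corner_symmetric // -split2.
have expand A : A *m aG x *m e *m aG y *m A = #|H|%:R^-1 *: \sum_(h in H)
    lam h^-1%g *: (A *m aG (x * h * y)%g *m A).
  rewrite /hecke_idem -scalemxAr -!scalemxAl; congr (_ *: _).
  rewrite mulmx_sumr !mulmx_suml; apply: eq_bigr => h hH.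
  rewrite -scalemxAr -!scalemxAl; congr (_ *: (_ *m _)).
  rewrite -!mulmxA -(repr_mxM _ (inG hH) yG) -(repr_mxM _ xG) ?mulgA //.
  exact: groupM (inG hH) yG.
rewrite expand linearZ linear_sum /=; congr (_ *: _); apply: eq_bigr => h hH.
by rewrite linearZ /= corner_symmetric // !groupM // inG.
Qed.

Let sG := DecSocleType (regular_repr algC G).
Local Notation Op i := (gring_op 'Chi_i%irr).

Lemma corner_mem x : x \in G -> (e *m aG x *m e \in R_G)%MS.
Proof. by move=> xG; rewrite !envelop_mxM ?hecke_idem_mem ?envelop_mx_id. Qed.

Lemma mem_Chi (i : Iirr G) A : (A \in enveloping_algebra_mx 'Chi_i)%MS.
Proof.
have /andP[_ full] := groupC (socle_irr (socle_of_Iirr i)).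
exact: submx_full full.
Qed.

(** By Frobenius reciprocity both sides are the average over H of [lam] against the conjugate of
    chi_i. *)
Lemma tr_hecke_idem (i : Iirr G) : \tr (Op i e) = '['Ind[G] lam, 'chi_i].
Proof.
rewrite -xcfun_repr irrRepr -Frobenius_reciprocity cfdotE /hecke_idem xcfunZr.
congr (_ * _); rewrite raddf_sum /= [RHS](reindex_inj invg_inj) /=.
rewrite [RHS](eq_bigl (mem H)) => [|k]; last by rewrite groupV.
apply: eq_bigr => h hH; rewrite xcfunZr xcfunG ?inG //.
by rewrite cfResE ?groupV // irr_inv conjCK.
Qed.

Lemma Op_corner (i : Iirr G) x : x \in G ->
  Op i (e *m aG x *m e) = Op i e *m 'Chi_i x *m Op i e.
Proof.
by move=> xG; rewrite !gring_opM ?hecke_idem_mem ?envelop_mx_id // gring_opG.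
Qed.

Lemma Op_idem (i : Iirr G) : Op i e *m Op i e = Op i e.
Proof. by rewrite -gring_opM ?hecke_idem_mem // hecke_idemK. Qed.

(** The matrices of an irreducible representation over [algC] span the full matrix algebra
    ([mem_Chi]), so commutation on group elements extends bilinearly. *)
Lemma Op_comm (i : Iirr G) A B :
  Op i e *m A *m Op i e *m B *m Op i e = Op i e *m B *m Op i e *m A *m Op i e.
Proof.
have comm x y : x \in G -> y \in G ->
    Op i e *m 'Chi_i x *m Op i e *m 'Chi_i y *m Op i e =
    Op i e *m 'Chi_i y *m Op i e *m 'Chi_i x *m Op i e.
  move=> xG yG; have := congr1 (Op i) (corner_comm xG yG).
  by rewrite !gring_opM ?hecke_idem_mem ?envelop_mx_id // !gring_opG.
have commx x : x \in G -> Op i e *m 'Chi_i x *m Op i e *m B *m Op i e =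
    Op i e *m B *m Op i e *m 'Chi_i x *m Op i e.
  move=> xG; have [b ->] := envelop_mxP (mem_Chi B).
  rewrite !(mulmx_sumr, mulmx_suml); apply: eq_bigr => y yG.
  by rewrite -!scalemxAr -!scalemxAl comm.
have [a ->] := envelop_mxP (mem_Chi A).
rewrite !(mulmx_sumr, mulmx_suml); apply: eq_bigr => x xG.
by rewrite -!scalemxAr -!scalemxAl commx.
Qed.

Lemma mult_le1 (i : Iirr G) : '['Ind[G] lam, 'chi_i] <= 1.
Proof.
have := comm_corner_tr3 (Op_idem i) (@Op_comm i); rewrite tr_hecke_idem.
have /natrP[m ->] := Cnat_cfdot_char (cfInd_char G (lin_charW lin)) (irr_char i).
rewrite -natrX => /eqP; rewrite eqr_nat lern1; case: m => [|[|m]] //.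
by rewrite -{2}(expn1 m.+2) eqn_exp2l.
Qed.

Let constit := [set i : Iirr G | '['Ind[G] lam, 'chi_i] == 1].

Lemma mult_bool (i : Iirr G) : '['Ind[G] lam, 'chi_i] = (i \in constit)%:R.
Proof.
have := mult_le1 i; rewrite inE.
have /natrP[m ->] := Cnat_cfdot_char (cfInd_char G (lin_charW lin)) (irr_char i).
by rewrite lern1 pnatr_eq1; case: m => [|[|m]].
Qed.

Lemma card_constit : '['Ind[G] lam] = #|constit|%:R.
Proof.
rewrite cfdot_sum_irr -sum1_card natr_sum [RHS]big_mkcond /=; apply: eq_bigr => i _.
by rewrite mult_bool; case: ifP => _; rewrite ?mul0r // conjC1 mulr1.
Qed.

(** For trace 0, [comm_corner_entries] with l = a and i = b says that the square of each entry is
    0. *)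
Lemma Op_eq0 (i : Iirr G) : i \notin constit -> Op i e = 0.
Proof.
move=> /negbTE i0; have tr_e := tr_hecke_idem i; rewrite mult_bool i0 in tr_e.
apply/matrixP=> a b; rewrite [RHS]mxE; apply/eqP; rewrite -sqrf_eq0 expr2.
by rewrite -(comm_corner_entries (Op_idem i) (@Op_comm i)) tr_e mulr0 mul0r.
Qed.

Lemma Op_scale (i : Iirr G) x : x \in G ->
  Op i (e *m aG x *m e) = \tr (Op i e *m 'Chi_i x) *: Op i e.
Proof.
move=> xG; rewrite Op_corner //; have [i1 | /Op_eq0->] := boolP (i \in constit).
  apply: comm_corner_scale; [exact: Op_idem | exact: Op_comm |].
  by rewrite tr_hecke_idem mult_bool i1.
by rewrite !mul0mx scaler0.
Qed.

Definition hecke_prim (i : Iirr G) : 'M[algC]_#|G| :=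
  Wedderburn_id (socle_of_Iirr i) *m e.

Lemma Wedderburn_id_group_ring (i : sG) : (Wedderburn_id i \in R_G)%MS.
Proof. by have := Wedderburn_id_mem i; rewrite genmxE mem_sub_gring => /andP[]. Qed.

Lemma hecke_prim_mem i : (hecke_prim i \in R_G)%MS.
Proof. by rewrite envelop_mxM ?Wedderburn_id_group_ring ?hecke_idem_mem. Qed.

(** The central idempotents sum to 1, and each Wedderburn component acts faithfully on its own
    irreducible. *)
Lemma group_ring_eq A B : (A \in R_G)%MS -> (B \in R_G)%MS ->
  (forall i, Op i A = Op i B) -> A = B.
Proof.
move=> RA RB eqAB; rewrite -[A]mul1mx -[B]mul1mx.
rewrite -(Wedderburn_sum_id_pchar sG (algC'G_pchar G)) !mulmx_suml.
apply: eq_bigr => W _; rewrite -(irr_of_socleK W); set i := irr_of_socle W.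
have R_e X : (X \in R_G)%MS ->
    (Wedderburn_id (socle_of_Iirr i) *m X \in Wedderburn_subring (socle_of_Iirr i))%MS.
  move=> RX; have /andP[_ /(submx_trans _)-> //] := Wedderburn_ideal (socle_of_Iirr i).
  by rewrite mem_mulsmx ?Wedderburn_id_mem.
have irrK := irr_reprK_pchar (algC'G_pchar G) (socle_of_Iirr i).
have inj := regular_op_inj_pchar (sG := DecSocleType (regular_repr algC G)) (algC'G_pchar G) (socle_irr (socle_of_Iirr i)).
rewrite irrK in inj; apply: inj; rewrite ?inE ?R_e //.
by rewrite !gring_opM // eqAB.
Qed.

Lemma Op_prim j i : Op j (hecke_prim i) = (i == j)%:R *: Op j e.
Proof.
rewrite /hecke_prim gring_opM ?hecke_idem_mem //; have [-> | neq] := eqVneq i j.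
  by rewrite op_Wedderburn_id_pchar ?algC'G_pchar // mul1mx scale1r.
rewrite (irr_repr'_op0_pchar _ _ (Wedderburn_id_mem _)) ?algC'G_pchar ?mul0mx ?scale0r //.
by rewrite (can_eq socle_of_IirrK).
Qed.

Lemma hecke_prim_mul i j : hecke_prim i *m hecke_prim j = (i == j)%:R *: hecke_prim i.
Proof.
apply: group_ring_eq => [||l].
- exact: envelop_mxM (hecke_prim_mem i) (hecke_prim_mem j).
- by rewrite linearZ scalemx_sub // hecke_prim_mem.
rewrite linearZ /= gring_opM ?hecke_prim_mem //= !Op_prim -scalemxAl -scalemxAr Op_idem !scalerA.
congr (_ *: _); have [<-|ij] := eqVneq i j; first by rewrite mul1r -natrM mulnb andbb.
have [il|_] := eqVneq i l; last by rewrite !mul0r.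
by rewrite -il eq_sym (negbTE ij) mulr0 mul0r.
Qed.

Lemma hecke_prim_corner i : e *m hecke_prim i *m e = hecke_prim i.
Proof.
have He := hecke_idem_mem; have HE := hecke_prim_mem i.
apply: group_ring_eq => [||l] //; first exact: envelop_mxM (envelop_mxM He HE) He.
by rewrite gring_opM // gring_opM // Op_prim -scalemxAr -scalemxAl !Op_idem.
Qed.

Lemma hecke_prim_neq0 i : i \in constit -> hecke_prim i != 0.
Proof.
move=> i1; apply/eqP=> E0; have := Op_prim i i; rewrite E0 linear0 eqxx scale1r => /esym Oe0.
by have /esym/eqP := tr_hecke_idem i; rewrite Oe0 mxtrace0 mult_bool i1 oner_eq0.
Qed.

Lemma corner_expand x : x \in G -> e *m aG x *m e =
  \sum_(i in constit) \tr (Op i e *m 'Chi_i x) *: hecke_prim i.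
Proof.
move=> xG; apply: group_ring_eq => [||j]; first exact: corner_mem.
  by rewrite linear_sum summx_sub // => i _; rewrite linearZ scalemx_sub ?hecke_prim_mem.
rewrite Op_scale // linear_sum /=.
have [j1 | j0] := boolP (j \in constit); last first.
  by rewrite Op_eq0 // scaler0 big1 // => i _; rewrite linearZ /= Op_prim Op_eq0 // !scaler0.
rewrite (bigD1 j) //= [X in _ = X + _]linearZ /= Op_prim eqxx scale1r big1 ?addr0 // => i /andP[_ /negbTE ij].
by rewrite linearZ /= Op_prim ij scale0r scaler0.
Qed.

Lemma hecke_idem_expand : e = \sum_(i in constit) hecke_prim i.
Proof.
apply: group_ring_eq => [||j]; first exact: hecke_idem_mem.
  by rewrite linear_sum summx_sub // => i _; rewrite hecke_prim_mem.
rewrite linear_sum /=.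
have [j1 | j0] := boolP (j \in constit); last first.
  by rewrite Op_eq0 // big1 // => i _; rewrite Op_prim Op_eq0 // scaler0.
rewrite (bigD1 j) //= Op_prim eqxx scale1r big1 ?addr0 // => i /andP[_ /negbTE ij].
by rewrite Op_prim ij scale0r.
Qed.

Section Transport.
Variables (C : numClosedFieldType) (iota : {rmorphism algC -> C}).
Local Notation E i := (map_mx iota (hecke_prim i)).

(** The decomposition is made over [algC], where the characters take their values; its idempotents
    are then carried to C entrywise by [iota]. *)
Lemma map_hecke_idem : hecke_idem iota G lam = map_mx iota e.
Proof.
rewrite /hecke_idem map_mxZ fmorphV rmorph_nat; congr (_ *: _); rewrite [RHS]raddf_sum /=.
apply: eq_bigr => h hH; rewrite map_mxZ; congr (_ *: _).
exact/esym/map_regular_mx.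
Qed.

Definition hecke_vect (v : {ffun 'I_#|constit| -> C^o}) : 'M[C]_#|G| :=
  \sum_j v j *: E (enum_val j).

Fact hecke_vect_linear : linear hecke_vect.
Proof.
move=> a u v; rewrite /hecke_vect scaler_sumr -big_split; apply: eq_bigr => j _.
by rewrite !ffunE scalerDl scalerA.
Qed.
HB.instance Definition _ := GRing.isLinear.Build _ _ _ _ _ hecke_vect_linear.

Lemma hecke_vect_mulE v j : hecke_vect v *m E (enum_val j) = v j *: E (enum_val j).
Proof.
rewrite /hecke_vect mulmx_suml (bigD1 j) //= big1 ?addr0 => [|k /negbTE kj];
  rewrite -scalemxAl -map_mxM hecke_prim_mul.
  by rewrite eqxx scale1r.
by rewrite (inj_eq enum_val_inj) kj scale0r map_mx0 scaler0.
Qed.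

Lemma hecke_vect_inj : injective hecke_vect.
Proof.
move=> u v eq_uv; apply/ffunP=> j; have := hecke_vect_mulE u j.
rewrite eq_uv hecke_vect_mulE => /eqP; rewrite -subr_eq0 -scalerBl scaler_eq0.
rewrite map_mx_eq0 (negbTE (hecke_prim_neq0 (enum_valP j))) orbF subr_eq0.
by move/eqP.
Qed.

Lemma hecke_vectE (c : Iirr G -> algC) :
  map_mx iota (\sum_(i in constit) c i *: hecke_prim i) =
  hecke_vect [ffun j => iota (c (enum_val j))].
Proof.
rewrite raddf_sum /= big_enum_val; apply: eq_bigr => j _.
by rewrite map_mxZ ffunE.
Qed.

Lemma hecke_iso_pow_constit : hecke_iso_pow iota G lam #|constit|.
Proof.
exists hecke_vect; split.
- exact: hecke_vect_inj.
- move=> M; split=> [[x xRG ->] | [v <-]].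
    rewrite map_hecke_idem; have [a ->] := envelop_mxP xRG.
    (* The coordinates of e g e are the scalars by which it acts on the constituents
       ([corner_expand]), extended linearly in g. *)
    exists (\sum_(g in G) a g *:
      ([ffun j => iota (\tr (Op (enum_val j) e *m 'Chi_(enum_val j) g))]
        : {ffun 'I_#|constit| -> C^o})).
    rewrite linear_sum mulmx_sumr mulmx_suml; apply: eq_bigr => g gG.
    rewrite linearZ -scalemxAr -scalemxAl; congr (_ *: _).
    transitivity (map_mx iota (e *m aG g *m e)); last by rewrite !map_mxM map_regular_mx.
    by rewrite corner_expand // hecke_vectE.
  exists (hecke_vect v).
    rewrite linear_sum summx_sub // => j _; rewrite linearZ scalemx_sub //.
    have [a ->] := envelop_mxP (hecke_prim_mem (enum_val j)).
    rewrite [map_mx _ _]raddf_sum linear_sum summx_sub //= => g gG.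
    by rewrite map_mxZ linearZ scalemx_sub //= map_regular_mx (envelop_mx_id (regular_repr C G)).
  rewrite map_hecke_idem mulmx_sumr mulmx_suml; apply: eq_bigr => j _.
  by rewrite -scalemxAr -scalemxAl -!map_mxM hecke_prim_corner.
- move=> u v; rewrite [in RHS]/hecke_vect mulmx_sumr; apply: eq_bigr => j _.
  by rewrite -scalemxAr hecke_vect_mulE scalerA ffunE mulrC.
rewrite map_hecke_idem hecke_idem_expand raddf_sum big_enum_val.
by apply: eq_bigr => j _; rewrite ffunE scale1r.
Qed.

End Transport.

Theorem gelfand_count (C : numClosedFieldType) (iota : {rmorphism algC -> C}) b :
  '['Ind[G] lam] = b%:R ->
  linear_gelfand_triple G lam /\ hecke_iso_pow iota G lam b.
Proof.
rewrite card_constit => /eqP; rewrite eqr_nat => /eqP <-; split.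
  by split=> // i; exact: mult_le1.
exact: hecke_iso_pow_constit.
Qed.

End GelfandTrick.

(** * Pairs of signed matchings *)

Local Open Scope nat_scope.

(* Two signed partial matchings mate false and mate true, as involutions      *)
(* commuting with the negation opp of signed points; pos c consists of the    *)
(* positive choices among the unmatched points, which are fixed by mate c.    *)
Record bimatch (T : Type) := BiMatch {
  opp : T -> T;
  mate : bool -> T -> T;
  pos : bool -> pred T }.

Section Walks.
Variables (T : finType) (S : bimatch T).

Record bimatch_axioms : Prop := BiMatchAxioms {
  oppK : involutive (opp S);
  opp_neq : forall x, opp S x != x;
  mateK : forall c, involutive (mate S c);
  mate_opp : forall c x, mate S c (opp S x) = opp S (mate S c x);
  mate_neq_opp : forall c x, mate S c x != opp S x;
  mate_fix : forall c x, (mate S c x == x) = pos S c x || pos S c (opp S x);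
  pos_opp : forall c x, pos S c x -> ~~ pos S c (opp S x) }.

Definition oppb (b : bool) (x : T) : T := if b then opp S x else x.

Fixpoint walk (i : nat) (x : T) : T :=
  if i is j.+1 then mate S (~~ odd j) (walk j x) else x.

(* x starts a component with m points up to opp, listed by the walk from x:   *)
(* a path from pos false to +-pos true if m is odd, a cycle if m is even.     *)
Definition typ (m : nat) (s : bool) (x : T) : bool :=
  [&& 0 < m,
      [forall i : 'I_m, forall j : 'I_m, (i < j) ==>
         (walk i x != walk j x) && (walk i x != opp S (walk j x))]
    & if odd m then pos S false x && pos S true (oppb s (walk m.-1 x))
      else walk m x == oppb s x].

Lemma typ_distinct m s x b : typ m s x ->
  forall i j, i < j -> j < m -> walk i x != oppb b (walk j x).
Proof.
case/and3P=> _ /forallP dist _ i j ij jm.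
have /forallP/(_ (Ordinal jm))/implyP/(_ ij) := dist (Ordinal (ltn_trans ij jm)).
by case: b => /andP[].
Qed.

Hypothesis wf : bimatch_axioms.

Lemma oppb_inj b : injective (oppb b).
Proof. by case: b => x y //= /(can_inj (oppK wf)). Qed.

Lemma oppbK b : involutive (oppb b).
Proof. by case: b => x //=; rewrite (oppK wf). Qed.

Lemma oppb_opp b x : oppb b (opp S x) = opp S (oppb b x).
Proof. by case: b. Qed.

Lemma oppbD a b x : oppb a (oppb b x) = oppb (a (+) b) x.
Proof. by case: a b => -[] //=; rewrite (oppK wf). Qed.

Lemma mate_oppb c b x : mate S c (oppb b x) = oppb b (mate S c x).
Proof. by case: b => //=; rewrite (mate_opp wf). Qed.

Lemma mate_neq_oppb c x : mate S c x != x -> forall b, mate S c x != oppb b x.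
Proof. by move=> neq [] //=; apply: mate_neq_opp. Qed.

Lemma pos_mate c x : pos S c x -> mate S c x = x.
Proof. by move=> px; apply/eqP; rewrite (mate_fix wf) px. Qed.

Lemma walk_back i x : mate S (~~ odd i) (walk i.+1 x) = walk i x.
Proof. exact: mateK. Qed.

Lemma walk_oppb i b x : walk i (oppb b x) = oppb b (walk i x).
Proof. by elim: i => //= i ->; rewrite mate_oppb. Qed.

(** When j - i is even, the last steps to positions i and j use the same mate, so both can be undone
    together until i reaches 0. *)
Lemma walk_shift b x i j : ~~ odd (j - i) -> i <= j ->
  walk i x = oppb b (walk j x) -> x = oppb b (walk (j - i) x).
Proof.
elim: i j => [|i IHi] [|j] //; rewrite ?subn0 // subSS => even_ji le_ij eq_w.
apply: IHi => //; have odd_ij : odd i = odd j.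
  by rewrite -(subnK (le_ij : i <= j)) oddD (negbTE even_ji).
by rewrite -walk_back eq_w mate_oppb odd_ij walk_back.
Qed.

(* Moving both meeting points one step towards each other, one finds two      *)
(* consecutive points of the walk that are equal up to opp.                   *)
Lemma walk_fold b x n i : (forall k, k < n -> walk k.+1 x != walk k x) ->
  forall j, i < j -> j <= n -> odd (j - i) -> walk i x != oppb b (walk j x).
Proof.
move=> moving j; have [d] := ubnP (j - i); elim: d i j => // d IHd i j.
rewrite ltnS => le_d lt_ij le_jn odd_ji; apply/eqP=> eq_w.
have odd_ij : odd i = ~~ odd j.
  by rewrite -(subnK (ltnW lt_ij)) oddD odd_ji /= negbK.
case: j => // j in le_d lt_ij le_jn odd_ji eq_w odd_ij *.
rewrite ltnS leq_eqVlt in lt_ij; have {lt_ij}[eq_ij|lt_ij] := orP lt_ij.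
  move: eq_ij eq_w le_jn => /eqP<- eq_w le_in.
  case/mate_neq_oppb/(_ b)/eqP: (moving i le_in).
  by rewrite -[LHS](oppbK b); congr (oppb b _).
have eq_w1 : walk i.+1 x = oppb b (walk j x).
  by rewrite /= eq_w mate_oppb odd_ij /= negbK walk_back.
have neq_ij : i.+1 != j by apply: contraTneq odd_ji => <-; lia.
by move: eq_w1; apply/eqP/IHd; lia.
Qed.

End Walks.

(** * Embeddings and disjoint unions *)

Section Morphisms.
Variables (T1 T2 : finType) (S1 : bimatch T1) (S2 : bimatch T2) (f : T1 -> T2).

Record embedding : Prop := Embedding {
  emb_inj : injective f;
  emb_opp : forall x, f (opp S1 x) = opp S2 (f x);
  emb_mate : forall c x, f (mate S1 c x) = mate S2 c (f x);
  emb_pos : forall c x, pos S2 c (f x) = pos S1 c x }.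

Hypothesis femb : embedding.

Lemma emb_oppb b x : f (oppb S1 b x) = oppb S2 b (f x).
Proof. by case: b => //=; rewrite (emb_opp femb). Qed.

Lemma emb_walk i x : f (walk S1 i x) = walk S2 i (f x).
Proof. by elim: i => //= i <-; rewrite (emb_mate femb). Qed.

Lemma emb_typ m s x : typ S2 m s (f x) = typ S1 m s x.
Proof.
rewrite /typ; congr [&& _, _ & _].
  apply: eq_forallb => i; apply: eq_forallb => j.
  by rewrite -!emb_walk -(emb_opp femb) !(inj_eq (emb_inj femb)).
by rewrite (emb_pos femb) -!emb_walk -!emb_oppb (emb_pos femb) (inj_eq (emb_inj femb)).
Qed.

Hypothesis wf2 : bimatch_axioms S2.

Lemma codom_oppb b y : (oppb S2 b y \in codom f) = (y \in codom f).
Proof.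
apply/codomP/codomP=> -[x eq_x]; exists (oppb S1 b x); rewrite emb_oppb.
  by rewrite -eq_x (oppbK wf2).
by rewrite eq_x.
Qed.

Lemma codom_mate c y : (mate S2 c y \in codom f) = (y \in codom f).
Proof.
apply/codomP/codomP=> -[x eq_x]; exists (mate S1 c x); rewrite (emb_mate femb).
  by rewrite -eq_x (mateK wf2).
by rewrite eq_x.
Qed.

Lemma codom_walk i y : (walk S2 i y \in codom f) = (y \in codom f).
Proof. by elim: i => //= i IHi; rewrite codom_mate. Qed.

End Morphisms.

Lemma embedding_comp (T1 T2 T3 : finType) (S1 : bimatch T1) (S2 : bimatch T2)
    (S3 : bimatch T3) (f : T1 -> T2) (g : T2 -> T3) :
  embedding S1 S2 f -> embedding S2 S3 g -> embedding S1 S3 (g \o f).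
Proof.
move=> [fi fo fm fp] [gi go gm gp]; split=> [|x|c x|c x] /=; first exact: inj_comp.
- by rewrite fo go.
- by rewrite fm gm.
by rewrite gp fp.
Qed.

Lemma embedding_inv (T1 T2 : finType) (S1 : bimatch T1) (S2 : bimatch T2)
    (f : T1 -> T2) (g : T2 -> T1) :
  cancel f g -> cancel g f -> embedding S1 S2 f -> embedding S2 S1 g.
Proof.
move=> fK gK [fi fo fm fp]; split=> [|x|c x|c x]; first exact: can_inj gK.
- by apply: fi; rewrite fo !gK.
- by apply: fi; rewrite fm !gK.
by rewrite -fp gK.
Qed.

Section Sum.
Variables (T1 T2 : finType) (S1 : bimatch T1) (S2 : bimatch T2).

Definition sum_map A B (f : T1 -> A) (g : T2 -> B) (z : T1 + T2) : A + B :=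
  match z with inl x => inl (f x) | inr y => inr (g y) end.

Definition bimatch_sum : bimatch (T1 + T2)%type := BiMatch
  (sum_map (opp S1) (opp S2))
  (fun c => sum_map (mate S1 c) (mate S2 c))
  (fun c z => match z with inl x => pos S1 c x | inr y => pos S2 c y end).

Lemma embedding_inl : embedding S1 bimatch_sum inl.
Proof. by split=> // x y []. Qed.

Lemma embedding_inr : embedding S2 bimatch_sum inr.
Proof. by split=> // x y []. Qed.

Lemma bimatch_sum_axioms :
  bimatch_axioms S1 -> bimatch_axioms S2 -> bimatch_axioms bimatch_sum.
Proof.
move=> [o1 n1 m1 c1 e1 f1 p1] [o2 n2 m2 c2 e2 f2 p2].
split=> [[x|x]|[x|x]|c [x|x]|c [x|x]|c [x|x]|c [x|x]|c [x|x]] //=;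
  by rewrite ?o1 ?o2 ?m1 ?m2 ?c1 ?c2 //;
     first [exact: n1 | exact: n2 | exact: e1 | exact: e2 | exact: f1 | exact: f2
           | exact: p1 | exact: p2].
Qed.

Lemma card_predsum (p : pred (T1 + T2)) :
  #|p| = #|[pred x | p (inl x)]| + #|[pred y | p (inr y)]|.
Proof.
by rewrite -!sum1_card big_sumType.
Qed.

Lemma embedding_join (T : finType) (S : bimatch T) (f : T1 -> T) (g : T2 -> T) :
  embedding S1 S f -> embedding S2 S g -> (forall x y, f x != g y) ->
  embedding bimatch_sum S (fun z => match z with inl x => f x | inr y => g y end).
Proof.
move=> [fi fo fm fp] [gi go gm gp] fg; split=> [|[x|x]|c [x|x]|c [x|x]] //=.
move=> [x|x] [y|y] //=; first by move/fi->.
- by move/eqP; rewrite (negbTE (fg _ _)).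
- by move/esym/eqP; rewrite (negbTE (fg _ _)).
by move/gi->.
Qed.

End Sum.

(** * Standard paths and cycles *)

Section Block.
Variables (m : nat) (s : bool).
Local Notation T := ('I_m * bool)%type.

(* The point (j, b) of a block stands for the j-th point of the walk from     *)
(* (0, false), negated if b. The walk moves j to j.+1 by mate (~~ odd j), and *)
(* closes up with sign s after m steps if m is even; (j, b) is mapped to      *)
(* (j', b (+) d) for (j', d) = step_raw c j.                                  *)
Definition step_raw (c : bool) (j : nat) : nat * bool :=
  if c == ~~ odd j then
    if j.+1 < m then (j.+1, false) else if odd m then (j, false) else (0, s)
  else
    if 0 < j then (j.-1, false) else if odd m then (0, false) else (m.-1, s).

(* The reversal of a path, and the reflection of a cycle that fixes (0, _),   *)
(* exchange the two matchings.                                                *)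
Definition swap_raw (j : nat) : nat * bool :=
  if odd m then (m.-1 - j, s) else if j == 0 then (0, false) else (m - j, s).

(* The default value of insubd is never reached, as h preserves [0, m).       *)
Definition lift_raw (h : nat -> nat * bool) (z : T) : T :=
  (insubd z.1 (h z.1).1, z.2 (+) (h z.1).2).

Definition block : bimatch T := BiMatch
  (fun z => (z.1, ~~ z.2))
  (fun c => lift_raw (step_raw c))
  (fun c z => odd m &&
     (if c then (z.1 == m.-1 :> nat) && (z.2 == s) else (z.1 == 0 :> nat) && ~~ z.2)).

Definition block_swap : T -> T := lift_raw swap_raw.

Lemma lift_rawE (h : nat -> nat * bool) (z z' : T) : (h z.1).1 < m ->
  (lift_raw h z == z') = ((h z.1).1 == z'.1) && (z.2 (+) (h z.1).2 == z'.2).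
Proof. by move=> lt; rewrite -pair_eqE /= /pair_eq /= -val_eqE val_insubd lt. Qed.

Lemma val_lift_raw (h : nat -> nat * bool) (z : T) : (h z.1).1 < m -> val (lift_raw h z).1 = (h z.1).1.
Proof. by move=> lt; rewrite /= val_insubd lt. Qed.

Lemma step_raw_lt c j : j < m -> (step_raw c j).1 < m.
Proof. by rewrite /step_raw; do !case: ifP => //=; lia. Qed.

Lemma swap_raw_lt j : j < m -> (swap_raw j).1 < m.
Proof. by rewrite /swap_raw; do !case: ifP => //=; lia. Qed.

Lemma step_rawK c j : j < m ->
  step_raw c (step_raw c j).1 = (j, (step_raw c j).2).
Proof.
move=> lt; rewrite /step_raw; case: c => /=; rewrite ?(eq_sym true) ?(eq_sym false) ?eqb_id ?eqbF_neg;
  repeat (case: ifP => /=); move=> *; solve [congr (_, _); lia | exfalso; lia].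
Qed.

Lemma step_raw_fix c j : j < m ->
  ((step_raw c j).1 == j) = odd m && (if c then j == m.-1 else j == 0).
Proof.
rewrite /step_raw => lt; case: c => /=;
  rewrite ?(eq_sym true) ?(eq_sym false) ?eqb_id ?eqbF_neg;
  repeat (case: ifP => /=); move=> *; lia.
Qed.

Lemma step_raw_odd c j : odd m -> (step_raw c j).2 = false.
Proof. by rewrite /step_raw => ->; do !case: ifP. Qed.

Lemma block_axioms : bimatch_axioms block.
Proof.
have fixE c (z : T) : (mate block c z == z) =
    odd m && (if c then z.1 == m.-1 :> nat else z.1 == 0 :> nat).
  rewrite lift_rawE ?step_raw_lt // step_raw_fix //.
  have [om|//] := boolP (odd m); by rewrite step_raw_odd // addbF eqxx andbT.
split=> [z|[i []]|c z|c z|c z|c z|c z] //=.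
- by case: z => i b /=; rewrite negbK.
- by rewrite -pair_eqE /= /pair_eq eqxx.
- by rewrite -pair_eqE /= /pair_eq eqxx.
- have lt := step_raw_lt c (ltn_ord z.1).
  apply/eqP; rewrite lift_rawE val_lift_raw ?step_raw_lt // step_rawK //= eqxx /=.
  by rewrite -addbA addbb addbF.
- by rewrite /lift_raw /= addNb.
- rewrite lift_rawE ?step_raw_lt //= step_raw_fix //.
  have [om|//] := boolP (odd m); rewrite step_raw_odd // addbF.
  by case: z.2; rewrite andbF.
- rewrite fixE; case: (odd m) => //=; case: c => /=.
    by rewrite -andb_orr; case: z.2; case: s; rewrite andbT.
  by rewrite -andb_orr orbN andbT.
move=> /andP[-> /=]; case: c => /= /andP[-> /=].
  by move/eqP->; case: s.
by move/negbTE->.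
Qed.

Lemma swap_rawK j : j < m -> swap_raw (swap_raw j).1 = (j, (swap_raw j).2).
Proof.
by rewrite /swap_raw => lt; repeat (case: ifP => /=); move=> *;
  solve [congr (_, _); lia | exfalso; lia].
Qed.

Lemma swap_rawM c j : j < m ->
  (step_raw c (swap_raw j).1).1 = (swap_raw (step_raw (~~ c) j).1).1 /\
  (step_raw c (swap_raw j).1).2 (+) (swap_raw j).2 =
  (swap_raw (step_raw (~~ c) j).1).2 (+) (step_raw (~~ c) j).2.
Proof.
rewrite /step_raw /swap_raw => lt; case: c => /=;
  rewrite ?(eq_sym true) ?(eq_sym false) ?eqb_id ?eqbF_neg;
  repeat (case: ifP => /=); move=> *;
  solve [split; [lia | by rewrite ?addbF ?addFb ?addbb] | exfalso; lia].
Qed.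

Lemma block_swapK : involutive block_swap.
Proof.
move=> z; apply/eqP; have lt := swap_raw_lt (ltn_ord z.1).
rewrite lift_rawE val_lift_raw ?swap_raw_lt // swap_rawK //= eqxx /=.
by rewrite -addbA addbb addbF.
Qed.

Lemma block_swap_opp z : block_swap (opp block z) = opp block (block_swap z).
Proof. by rewrite /block_swap /lift_raw /= addNb. Qed.

Lemma block_swap_mate c z : mate block c (block_swap z) = block_swap (mate block (~~ c) z).
Proof.
have ltw := swap_raw_lt (ltn_ord z.1); have lts := step_raw_lt (~~ c) (ltn_ord z.1).
have [eq1 eq2] := swap_rawM c (ltn_ord z.1).
apply/eqP; rewrite lift_rawE val_lift_raw ?step_raw_lt //.
rewrite val_lift_raw ?val_lift_raw ?swap_raw_lt // eq1 eqxx /=.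
by rewrite !val_insubd lts -!addbA [X in _ (+) X == _]addbC eq2 [X in _ == _ (+) X]addbC.
Qed.

Lemma block_swap_pos c z : pos block c (block_swap z) = pos block (~~ c) z.
Proof.
rewrite /= val_insubd swap_raw_lt // /swap_raw; case: (boolP (odd m)) => //= om.
have lt := ltn_ord z.1; case: c => /=; congr (_ && _).
- by lia.
- by case: z.2; case: s.
- by lia.
- by case: z.2; case: s.
Qed.

Lemma block_walk (m_gt0 : 0 < m) i : i < m ->
  walk block i (Ordinal m_gt0, false) = (insubd (Ordinal m_gt0) i, false).
Proof.
elim: i => [|i IHi] lt; first by congr (_, _); apply: val_inj; rewrite val_insubd m_gt0.
rewrite [LHS]/= IHi ?(ltnW lt) //; apply/eqP; rewrite lift_rawE ?step_raw_lt //=.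
rewrite !val_insubd lt (ltnW lt) /step_raw eqxx lt /=.
by rewrite eqxx.
Qed.

Lemma block_walkE (m_gt0 : 0 < m) (z : T) :
  z = oppb block z.2 (walk block z.1 (Ordinal m_gt0, false)).
Proof.
rewrite block_walk // /oppb; case: z => i b /=.
have -> : insubd (Ordinal m_gt0) i = i by apply: val_inj; rewrite val_insubd ltn_ord.
by case: b.
Qed.

Lemma typ_block (m_gt0 : 0 < m) : typ block m s (Ordinal m_gt0, false).
Proof.
rewrite /typ m_gt0 /=; apply/andP; split.
  apply/'forall_'forall_implyP => i j ij; rewrite !block_walk //=.
  rewrite -!pair_eqE /= /pair_eq /= andbF andbT -val_eqE /= !val_insubd !ltn_ord.
  by rewrite (ltn_eqF ij).
have lt : m.-1 < m by rewrite prednK.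
have walk_last := block_walk m_gt0 lt; case: ifP => om.
  rewrite walk_last; case: s => /=; rewrite val_insubd lt !eqxx om //=.
have -> : walk block m (Ordinal m_gt0, false) =
    walk block m.-1.+1 (Ordinal m_gt0, false) by congr (walk _ _ _); rewrite prednK.
rewrite [walk _ _ _]/= walk_last.
have -> : oppb block s (Ordinal m_gt0, false) = (Ordinal m_gt0, s) by case: s.
rewrite lift_rawE /= ?step_raw_lt // val_insubd lt /step_raw eqxx.
by rewrite (prednK m_gt0) ltnn om /= !eqxx.
Qed.

End Block.

Section Components.
Variables (T : finType) (S : bimatch T).
Hypothesis wf : bimatch_axioms S.

(** Distinctness in [typ] gives injectivity. Inside the walk the mates lead to neighbours, and the
    last clause of [typ] settles the two ends. *)
Lemma typ_embedding m s x : typ S m s x ->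
  embedding (block m s) S (fun z => oppb S z.2 (walk S z.1 x)).
Proof.
move=> typx; have /and3P[m_gt0 _ ends] := typx.
have walk_inj (i j : 'I_m) b : walk S i x = oppb S b (walk S j x) -> i = j /\ b = false.
  have [lt|lt|eq_ij] := ltngtP i j.
  - by move/eqP; rewrite (negbTE (typ_distinct b typx lt (ltn_ord j))).
  - move/(congr1 (oppb S b)); rewrite oppbK // => /esym/eqP.
    by rewrite (negbTE (typ_distinct b typx lt (ltn_ord i))).
  move/val_inj: eq_ij => ->; case: b => // /esym/eqP.
  by rewrite (negbTE (opp_neq wf _)).
have step (c : bool) (i : nat) : i < m ->
    mate S c (walk S i x) = oppb S (step_raw m s c i).2 (walk S (step_raw m s c i).1 x).
  move=> lt_im; rewrite /step_raw; case: eqP => [-> | /eqP nc].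
    case: ltnP => //= ge; have mE : m = i.+1 by apply/eqP; rewrite eqn_leq ge lt_im.
    move: ends; rewrite mE /=; case: ifP => oi /=.
      by case/andP=> _ /(pos_mate wf); rewrite mate_oppb // => /(oppb_inj wf).
    by rewrite oi => /eqP.
  have cE : c = odd i by move: nc; case: c; case: odd.
  case: posnP => [i0 | i_gt0] /=; last first.
    by rewrite -{1}(prednK i_gt0) -[RHS](walk_back wf) cE -{1}(prednK i_gt0) /= .
  rewrite i0 /= in cE *; case: ifP ends => om; first by case/andP=> /(pos_mate wf) + _; rewrite cE.
  rewrite -(prednK m_gt0) /= => /eqP eqx.
  have om' : odd m.-1 by lia.
  by rewrite -[x in LHS](oppbK wf s) -eqx om' cE mate_oppb // (mateK wf).
split=> [[i a] [j b] /= eq_w | [i a] | c [i a] | c [i a]] /=.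
- have := walk_inj i j (a (+) b); rewrite -(oppbD wf) -eq_w oppbK // => -[] // <-.
  by case: a b {eq_w} => -[].
- by rewrite /oppb; case: a => //=; rewrite (oppK wf).
- by rewrite val_insubd step_raw_lt // mate_oppb // step // oppbD.
have fixE : (mate S c (walk S i x) == walk S i x) =
    odd m && (if c then i == m.-1 :> nat else i == 0 :> nat).
  rewrite step // -(step_raw_fix s c (ltn_ord i)).
  have lt' := step_raw_lt s c (ltn_ord i); have [om | em] := boolP (odd m).
    rewrite step_raw_odd //=; apply/eqP/eqP => [eq_w | -> //].
    by have [] := walk_inj (Ordinal lt') i false eq_w => /(congr1 val).
  apply/eqP/eqP => [eq_w | eq_i].
    have := walk_inj (Ordinal lt') i (step_raw m s c i).2.
    by rewrite /= -eq_w oppbK // => -[] // /(congr1 val).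
  have := step_raw_fix s c (ltn_ord i); rewrite eq_i eqxx (negbTE em) //.
have posE b : pos S c (oppb S b (walk S i x)) ->
   odd m && (if c then i == m.-1 :> nat else i == 0 :> nat).
  rewrite -fixE => /(pos_mate wf); rewrite mate_oppb // => /(oppb_inj wf)->.
  exact: eqxx.
have pos_unique b d y : pos S c (oppb S b y) -> pos S c (oppb S d y) = (d == b).
  move=> py; case: (d =P b) => [-> // | /eqP db]; apply/negbTE.
  have -> : oppb S d y = opp S (oppb S b y); last exact: pos_opp.
  by case: b d db {py} => -[] //= _; rewrite (oppK wf).
apply/idP/idP=> [pz | /andP[om]]; move: ends.
  have /andP[om pos_i] := posE _ pz; rewrite om => /andP[p0 p1].
  case: c pos_i pz {step fixE posE} pos_unique => /eqP i_end pz pos_unique /=;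
    rewrite i_end eqxx /=.
    by rewrite i_end (pos_unique s) in pz.
  by rewrite i_end (pos_unique false) in pz; rewrite // (eqP pz).
rewrite om; case: c {step fixE posE pos_unique} => /andP[p0 p1] /andP[/eqP-> ].
  by move/eqP->.
by move/negbTE->.
Qed.

End Components.

Lemma walk_double (T : finType) (S : bimatch T) i x :
  walk S i.*2 x = iter i (mate S false \o mate S true) x.
Proof. by elim: i => //= i <-; rewrite odd_double. Qed.

(* The points where rho ^ i = opp ^ b, for rho the product of the two mates,  *)
(* form a union of components, since each mate inverts rho.                   *)
Lemma iter_rho_mate (T : finType) (S : bimatch T) i b c x : bimatch_axioms S ->
  iter i (mate S false \o mate S true) x = oppb S b x ->
  iter i (mate S false \o mate S true) (mate S c x) = oppb S b (mate S c x).
Proof.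
move=> wf; set rho := _ \o _ => eq_x; pose rhoV := mate S true \o mate S false.
have rhoK : cancel rho rhoV by move=> y; rewrite /rho /rhoV /= !(mateK wf).
have iterV_oppb k y : iter k rhoV (oppb S b y) = oppb S b (iter k rhoV y).
  by elim: k => //= k ->; rewrite /rhoV /= !(mate_oppb wf).
have conj k y : iter k rho (mate S c y) = mate S c (iter k rhoV y).
  by elim: k => //= k ->; rewrite /rho /rhoV /=; case: c; rewrite ?(mateK wf).
have iterK k y : iter k rhoV (iter k rho y) = y.
  by elim: k => // k IHk; rewrite iterSr [iter k.+1 rho y]iterS rhoK.
rewrite conj -(mate_oppb wf); congr (mate S c _); apply: (oppb_inj wf (b := b)).
by rewrite -iterV_oppb -eq_x iterK eq_x (oppbK wf).
Qed.

(** A block is connected, so an embedded component fills it and m' = m by counting. The sign is read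
    at the far end of a path from its unique start, and on a cycle from rho ^ (m/2) = opp ^ s, which
    holds everywhere once it holds at one point. *)
Lemma typ_block_inv m s m' s' z : typ (block m s) m' s' z -> (m', s') = (m, s).
Proof.
move=> typz; have m_gt0 : 0 < m by case: (z.1) => i; apply: leq_trans.
have m'_gt0 : 0 < m' by case/andP: typz.
have wf := block_axioms m s; have Femb := typ_embedding wf typz.
set F := (fun _ => _) in Femb; pose z0 : 'I_m * bool := (Ordinal m_gt0, false).
have zF : z \in codom F by exact: (codom_f F (Ordinal m'_gt0, false)).
have z0F : z0 \in codom F.
  by move: zF; rewrite {1}(block_walkE s m_gt0 z) (codom_oppb Femb) // (codom_walk Femb).
have F_onto y : y \in codom F.
  by rewrite (block_walkE s m_gt0 y) (codom_oppb Femb) // (codom_walk Femb).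
have eq_m : m' = m.
  have : #|{: 'I_m' * bool}| = #|{: 'I_m * bool}|.
    apply/eqP; rewrite eqn_leq (leq_card F (emb_inj Femb)) /=.
    by rewrite -(card_codom (emb_inj Femb)); apply/subset_leq_card/subsetP=> y _; apply: F_onto.
  by rewrite !card_prod !card_ord card_bool; lia.
move: {F Femb zF z0F F_onto} typz; rewrite eq_m => /and3P[_ _].
case: ifP => om.
  move=> /andP[pos_z pos_last]; have zE : z = z0.
    case: z pos_z {pos_last} => i b /=; rewrite om /= => /andP[/eqP i0 /negbTE->].
    by congr (_, _); apply: val_inj.
  move: pos_last; rewrite zE block_walk ?prednK // => pos_last; congr (_, _).
  by move: pos_last; rewrite /oppb; case: s' => /= /andP[_ /andP[_ /eqP]].
have even_m : m = m./2.*2 by lia.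
pose rho := mate (block m s) false \o mate (block m s) true.
have walk_m y : walk (block m s) m y = iter m./2 rho y.
  by rewrite -walk_double -even_m.
have rho0 : iter m./2 rho z0 = oppb (block m s) s z0.
  by have /and3P[_ _] := typ_block s m_gt0; rewrite om walk_m => /eqP.
have rho_all i : iter m./2 rho (walk (block m s) i z0) = oppb (block m s) s (walk (block m s) i z0).
  by elim: i => // i IHi; apply: iter_rho_mate.
have rhoz : iter m./2 rho z = oppb (block m s) s z.
  rewrite (block_walkE s m_gt0 z) -walk_m (walk_oppb wf) walk_m rho_all.
  by rewrite !(oppbD wf) addbC.
rewrite walk_m rhoz => /eqP eq_s; congr (_, _).
have z_opp := negbTE (opp_neq wf z).
by move: eq_s; case: (s) (s') => -[] //= /eqP; rewrite ?[z == _]eq_sym z_opp.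
Qed.

(** * Disjoint unions of standard components and their invariants *)

Fixpoint std_type (l : seq (nat * bool)) : finType :=
  if l is p :: l' then ('I_p.1 * bool + std_type l')%type : finType else void.

Fixpoint std (l : seq (nat * bool)) : bimatch (std_type l) :=
  if l is p :: l' as l return bimatch (std_type l)
  then bimatch_sum (block p.1 p.2) (std l')
  else @BiMatch void id (fun=> id) (fun _ _ => false).

Lemma std_axioms l : bimatch_axioms (std l).
Proof.
elim: l => [|p l IHl] /=; first by split=> // -[].
exact: bimatch_sum_axioms (block_axioms _ _) IHl.
Qed.

Fixpoint std_swap l : std_type l -> std_type l :=
  if l is p :: l' as l return std_type l -> std_type l
  then sum_map (@block_swap p.1 p.2) (@std_swap l') else id.

Lemma std_swapK l : involutive (@std_swap l).
Proof. by elim: l => [|p l IHl] [] //= z; rewrite ?block_swapK ?IHl. Qed.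

Lemma std_swap_opp l z : std_swap (opp (std l) z) = opp (std l) (std_swap z).
Proof. by elim: l z => [|p l IHl] [] //= z; rewrite ?block_swap_opp ?IHl. Qed.

Lemma std_swap_mate l c z :
  mate (std l) c (std_swap z) = std_swap (mate (std l) (~~ c) z).
Proof.
elim: l z => [|p l IHl] [] z; [congr inl | congr inr].
  exact: block_swap_mate.
exact: IHl.
Qed.

Lemma std_swap_pos l c z : pos (std l) c (std_swap z) = pos (std l) (~~ c) z.
Proof.
elim: l z => [|p l IHl] [] z //; last exact: IHl.
exact: block_swap_pos.
Qed.

Lemma card_std_pos l c : #|pos (std l) c| = #|pos (std l) false|.
Proof.
case: c => //; rewrite -(card_image (can_inj (@std_swapK l)) (pos (std l) false)).
apply: eq_card => z; rewrite -[z in RHS]std_swapK mem_image; last exact: can_inj (@std_swapK l).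
by rewrite -[z in LHS]std_swapK -!topredE /= std_swap_pos.
Qed.

Lemma card_std_type l : #|std_type l| = 2 * sumn [seq p.1 | p <- l].
Proof.
elim: l => [|p l IHl] /=; first by rewrite card_void.
by rewrite card_sum card_prod card_ord card_bool IHl; lia.
Qed.

Lemma card_std_pos_odd l : all (fun p => 0 < p.1) l ->
  #|pos (std l) false| = count (fun p => odd p.1) l.
Proof.
elim: l => [_|[m s] l IHl /= /andP[m_gt0 /IHl <-]].
  by rewrite eq_card0.
rewrite (card_predsum (T1 := ('I_m * bool)%type)); congr (_ + _).
have [om|/negbTE om] := boolP (odd m); last first.
  by rewrite eq_card0 // => z; rewrite !inE /= om.
rewrite (eq_card1 (x := (Ordinal m_gt0, false))) // => z.
rewrite !inE /=.
by case: z => i [] //=; rewrite -pair_eqE /= /pair_eq /= ?andbF ?andbT.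
Qed.

Section Counts.
Variables (m : nat) (s : bool).

Definition typ_count (T : finType) (S : bimatch T) : nat := #|[pred x | typ S m s x]|.

Lemma typ_count_sum (T1 T2 : finType) (S1 : bimatch T1) (S2 : bimatch T2) :
  typ_count (bimatch_sum S1 S2) = typ_count S1 + typ_count S2.
Proof.
rewrite /typ_count card_predsum; congr (_ + _); apply: eq_card => z; rewrite !inE /=.
  exact: (emb_typ (embedding_inl S1 S2)).
exact: (emb_typ (embedding_inr S1 S2)).
Qed.

(** By [typ_block_inv] only blocks of type (m, s) contain starting points of that type; these counts
    therefore recover the multiplicities of the blocks. *)
Lemma typ_count_std l :
  typ_count (std l) = count_mem (m, s) l * typ_count (block m s).
Proof.
elim: l => [|[m' s'] l IHl] /=.
  by rewrite /typ_count eq_card0 // => -[].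
rewrite typ_count_sum IHl mulnDl; congr (_ + _); rewrite xpair_eqE.
have [/eqP[-> ->]|neq] := boolP ((m', s') == (m, s)).
  by rewrite !eqxx mul1n.
rewrite -xpair_eqE (negbTE neq) mul0n /typ_count eq_card0 // => z; rewrite !inE.
by apply: contraNF neq => /typ_block_inv ->.
Qed.

Lemma typ_count_block_gt0 : 0 < m -> 0 < typ_count (block m s).
Proof.
by move=> m_gt0; apply/card_gt0P; exists (Ordinal m_gt0, false); rewrite inE typ_block.
Qed.

End Counts.

Lemma typ_count_emb (T1 T2 : finType) (S1 : bimatch T1) (S2 : bimatch T2) f m s :
  embedding S1 S2 f -> {in [pred x | typ S2 m s x], forall x, x \in codom f} ->
  typ_count m s S1 = typ_count m s S2.
Proof.
move=> femb onto; rewrite /typ_count -(card_image (emb_inj femb)).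
apply: eq_card => y; apply/imageP/idP => [[x typx ->] | typy].
  by rewrite inE (emb_typ femb).
have /codomP[x eq_y] := onto _ typy; exists x => //.
by rewrite inE -(emb_typ femb) -eq_y.
Qed.

Section Classification.
Variables (T : finType) (S : bimatch T).
Hypothesis wf : bimatch_axioms S.

(** The image of f is closed under the mates and [opp], so a component starting outside it is
    disjoint from it. *)
Lemma std_extend l f m s x : embedding (std l) S f -> typ S m s x -> x \notin codom f ->
  exists g, embedding (std ((m, s) :: l)) S g.
Proof.
move=> femb typx xf; eexists; apply: (embedding_join (typ_embedding wf typx) femb).
move=> z y; apply: contra xf => /eqP eq_y.
by rewrite -(codom_walk femb wf z.1) -(codom_oppb femb wf z.2) eq_y codom_f.
Qed.

(** Blocks are added greedily: if no starting point of type (m, s) were left outside the image, S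
    would have only as many as [std l], too few for the additional block. *)
Lemma std_embed l : all (fun p => 0 < p.1) l ->
  (forall m s, count_mem (m, s) l * typ_count m s (block m s) <= typ_count m s S) ->
  exists f, embedding (std l) S f.
Proof.
elim: l => [_ _|[m s] l IHl /= /andP[m_gt0 l_gt0] le_count].
  by exists (fun z : void => match z with end); split=> -[].
have [|f femb] := IHl l_gt0.
  by move=> m' s'; apply: leq_trans (le_count m' s'); rewrite leq_mul2r leq_addl orbT.
have [x /andP[typx xf]|onto] := pickP [pred x | typ S m s x && (x \notin codom f)].
  exact: std_extend femb typx xf.
have := le_count m s; rewrite eqxx -(typ_count_emb femb) ?typ_count_std; last first.
  by move=> x; rewrite inE => typx; have := onto x; rewrite /= typx /= => /negbFE.
by rewrite leq_mul2r add1n ltnn orbF eqn0Ngt typ_count_block_gt0.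
Qed.

End Classification.

Lemma embedding_bij (T1 T2 : finType) (S1 : bimatch T1) (S2 : bimatch T2) f :
  embedding S1 S2 f -> #|T2| <= #|T1| ->
  exists2 g, cancel f g & cancel g f /\ embedding S2 S1 g.
Proof.
move=> femb le; have [g fK gK] := inj_card_bij (emb_inj femb) le.
by exists g; last by split; last exact: embedding_inv femb.
Qed.

Lemma std_perm (l l' : seq (nat * bool)) : all (fun p => 0 < p.1) l -> perm_eq l l' ->
  exists f, embedding (std l') (std l) f.
Proof.
move=> l_gt0 eq_l; apply: std_embed; first exact: std_axioms.
  by rewrite -(perm_all _ eq_l).
by move=> m s; rewrite typ_count_std (seq.permP eq_l).
Qed.

Lemma std_iso_perm l l' f : all (fun p => 0 < p.1) l -> all (fun p => 0 < p.1) l' ->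
  embedding (std l) (std l') f -> #|std_type l'| <= #|std_type l| -> perm_eq l l'.
Proof.
move=> l_gt0 l'_gt0 femb le; have [g _ [gK _]] := embedding_bij femb le.
rewrite /perm_eq; apply/allP=> -[m s]; rewrite mem_cat => ms.
have m_gt0 : 0 < m by case/orP: ms => [/(allP l_gt0)|/(allP l'_gt0)].
rewrite /= -(eqn_pmul2r (typ_count_block_gt0 s m_gt0)) -!typ_count_std.
by apply/eqP/(typ_count_emb femb) => x _; rewrite -[x]gK codom_f.
Qed.

(** * Decomposition of pairs without bad paths *)

Section Good.
Variables (T : finType) (S : bimatch T).
Hypothesis wf : bimatch_axioms S.

(* No path component has both its ends in +-pos false. *)
Definition good : Prop := forall x i, pos S false x ->
  mate S false (walk S i.*2 x) = walk S i.*2 x -> walk S i.*2 x = x.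

Lemma walk_returns x : exists2 n, 0 < n & walk S n.*2 x = x.
Proof.
pose rho := mate S false \o mate S true.
have rho_inj : injective rho.
  by apply: inj_comp; apply: can_inj (mateK wf _).
by exists (fingraph.order rho x); rewrite ?fingraph.order_gt0 // walk_double iter_order.
Qed.

Lemma typ_path x : good -> pos S false x -> exists m s, typ S m s x.
Proof.
move=> gS px; have [n0 n0_gt0 ret] := walk_returns x.
have mx := pos_mate wf px.
(* The walk returns to x after an even number of steps; the last one uses [mate false], which fixes
   x, so it was stationary. *)
have ex_stuck : exists i, walk S i.+1 x == walk S i x.
  exists n0.*2.-1; have := walk_back wf n0.*2.-1 x; rewrite prednK ?double_gt0 //.
  have -> : ~~ odd n0.*2.-1 = false by lia.
  by rewrite ret mx => <-.
have [n /eqP stuck n_min] := ex_minnP ex_stuck => {ex_stuck}.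
have moving k : k < n -> walk S k.+1 x != walk S k x.
  by move=> lt_kn; apply: contraL lt_kn => /n_min; rewrite -leqNgt.
have dist b i j : i < j -> j <= n -> walk S i x != oppb S b (walk S j x).
  move=> lt_ij le_jn; have [odd_ji|even_ji] := boolP (odd (j - i)).
    exact: (walk_fold wf b moving lt_ij le_jn odd_ji).
  apply/eqP=> /(walk_shift wf even_ji (ltnW lt_ij)) eq_x.
  have d_gt0 : 0 < j - i by rewrite subn_gt0.
  case: (j - i) d_gt0 even_ji eq_x (leq_trans (leq_subr i j) le_jn) => // d _ even_d eq_x lt_dn.
  have fix_d : mate S false (walk S d.+1 x) = walk S d.+1 x.
    by apply: (oppb_inj wf (b := b)); rewrite -(mate_oppb wf) -eq_x.
  have even_c : ~~ odd d = false by move: even_d => /=; case: odd.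
  by have /eqP[] := moving d lt_dn; rewrite -[RHS](walk_back wf) even_c fix_d.
(* A walk stuck after an odd number of steps is at a point fixed by [mate false]; [good] makes this
   point x itself, against distinctness. *)
have even_n : ~~ odd n.
  apply/negP=> odd_n; have := walk_back wf n x; rewrite odd_n -stuck => fix_n.
  have n1 : n.+1 = (n.+1)./2.*2 by lia.
  have := gS x (n.+1)./2 px; rewrite -n1 => /(_ fix_n) eq_x.
  have n_gt0 : 0 < n by case: (n) odd_n.
  by have /eqP[] := dist false 0 n n_gt0 (leqnn n); rewrite /= -stuck eq_x.
have [s pos_s] : exists s, pos S true (oppb S s (walk S n x)).
  have : mate S true (walk S n x) == walk S n x by rewrite -{2}stuck /= even_n.
  rewrite (mate_fix wf) => /orP[p|p]; [by exists false | by exists true].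
exists n.+1, s; apply/and3P; split=> //; last by rewrite /= even_n px.
apply/'forall_'forall_implyP => i j ij; rewrite -ltnS in ij *.
have le_jn : j <= n by rewrite -ltnS.
by rewrite (dist false i j ij le_jn) (dist true i j ij le_jn).
Qed.

(** The first return to x up to sign closes the component; as no step is stationary, [walk_fold]
    excludes an odd length. *)
Lemma typ_cycle x : (forall i, walk S i.+1 x != walk S i x) -> exists m s, typ S m s x.
Proof.
move=> moving; have [n0 n0_gt0 ret] := walk_returns x.
have ex_ret : exists m, (0 < m) && ((walk S m x == x) || (walk S m x == opp S x)).
  by exists n0.*2; rewrite double_gt0 n0_gt0 ret eqxx.
have [m /andP[m_gt0 ret_m] m_min] := ex_minnP ex_ret => {ex_ret}.
have [s eq_s] : exists s, walk S m x = oppb S s x.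
  by case/orP: ret_m => /eqP; [exists false | exists true].
have m_least b d : 0 < d -> d < m -> x != oppb S b (walk S d x).
  move=> d_gt0 lt_dm; apply/eqP=> eq_x; have := m_min d; rewrite d_gt0 leqNgt lt_dm.
  have : walk S d x = oppb S b x by rewrite {2}eq_x oppbK.
  by case: (b) => /= ->; rewrite eqxx ?orbT => /(_ isT).
have fold := walk_fold wf _ (fun k (_ : k < m) => moving k).
have even_m : ~~ odd m.
  by apply/negP; rewrite -[X in odd X]subn0 => /(fold s _ _ m_gt0 (leqnn m))/eqP[]; rewrite eq_s oppbK.
exists m, s; apply/and3P; split=> //; last by rewrite (negbTE even_m) eq_s.
have dist b (i j : 'I_m) : i < j -> walk S i x != oppb S b (walk S j x).
  move=> ij; have [odd_ji|even_ji] := boolP (odd (j - i)).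
    exact: fold ij (ltnW (ltn_ord j)) odd_ji.
  apply/eqP=> /(walk_shift wf even_ji (ltnW ij)); apply/eqP/m_least.
    by rewrite subn_gt0.
  exact: leq_ltn_trans (leq_subr i j) (ltn_ord j).
by apply/'forall_'forall_implyP => i j ij; rewrite (dist false) // (dist true).
Qed.

Definition typed (l : seq (nat * bool)) : Prop :=
  forall p, p \in l -> exists x, typ S p.1 p.2 x.

Lemma typed_gt0 l : typed l -> all (fun p => 0 < p.1) l.
Proof. by move=> typ_l; apply/allP=> p /typ_l[x /and3P[]]. Qed.

(** Uncovered points of [pos false] start new paths. Once all are covered, equality of the two
    counts shows that [pos true] is covered too, and any uncovered point then lies on a cycle. *)
Lemma classification : good -> #|pos S false| = #|pos S true| ->
  exists l, [/\ typed l, #|std_type l| = #|T| & exists f, embedding (std l) S f].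
Proof.
move=> gS eq_pos.
have [l [typ_l le_l [f femb]]] : exists l, [/\ typed l, #|T| <= #|std_type l|
    & exists f, embedding (std l) S f].
  (* The second [#|T|] becomes the induction parameter, a bound on the number of uncovered
     points. *)
  have : exists l, [/\ typed l, #|T| <= #|std_type l| + #|T|
    & exists f, embedding (std l) S f].
    exists [::]; split; rewrite ?leq_addl //.
    by exists (fun z : void => match z with end); split=> -[].
  elim: {2}#|T| => [|N IHN] [l [typ_l le_l [f femb]]].
    by rewrite addn0 in le_l; exists l; split=> //; exists f.
  have [onto | ] := boolP [forall x, x \in codom f].
    exists l; split=> //; last by exists f.
    rewrite -(card_codom (emb_inj femb)); apply/subset_leq_card/subsetP=> x _.
    exact: (forallP onto).
  rewrite negb_forall => /existsP[x0 x0f].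
  suffices [m [s [x typx xf]]] : exists m s, exists2 x, typ S m s x & x \notin codom f.
    have [g gemb] := std_extend wf femb typx xf.
    apply: IHN; exists ((m, s) :: l); split; last by exists g.
      by move=> p; rewrite inE => /orP[/eqP-> | /typ_l //]; exists x.
    apply: leq_trans le_l _; rewrite [#|std_type (_ :: _)|]/= card_sum card_prod card_ord card_bool.
    by have /and3P[] := typx; lia.
  have [x /andP[px xf]|pos0] := pickP [pred x | pos S false x && (x \notin codom f)].
    by have [m [s typx]] := typ_path gS px; exists m, s, x.
  have pos_image c : pos S c \subset codom f.
    have sub0 : [set y in pos S false] = [set f z | z in pos (std l) false].
      apply/setP=> y; rewrite inE; apply/idP/imsetP => [py | [z pz ->]].
        have := pos0 y; rewrite /= [pos S false y]py => /negbFE/codomP[z eq_y].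
        by exists z; rewrite // -topredE /= -(emb_pos femb) -eq_y.
      by rewrite -topredE /= (emb_pos femb).
    have sub1 : [set f z | z in pos (std l) true] = [set y in pos S true].
      apply/eqP; rewrite eqEcard; apply/andP; split.
        by apply/subsetP=> _ /imsetP[z pz ->]; rewrite inE -topredE /= (emb_pos femb).
      rewrite cardsE -eq_pos -(cardsE (pos S false)) sub0 !card_imset ?card_std_pos //;
      exact: emb_inj femb.
    apply/subsetP=> y py.
    have : y \in [set y in pos S c] by rewrite inE.
    by case: c py => py; rewrite -?sub1 ?sub0 => /imsetP[z _ ->]; apply: codom_f.
  have [|m [s typx]] := @typ_cycle x0; last by exists m, s, x0.
  move=> i; rewrite /= (mate_fix wf); apply: contra x0f => p.
  rewrite -(codom_walk femb wf i); case/orP: p => /(subsetP (pos_image _)) //.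
  by rewrite (codom_oppb femb wf true).
exists l; split=> //; last by exists f.
by apply/eqP; rewrite eqn_leq le_l andbT (leq_card f (emb_inj femb)).
Qed.

End Good.

Lemma good_emb (T1 T2 : finType) (S1 : bimatch T1) (S2 : bimatch T2) f :
  embedding S1 S2 f -> good S2 -> good S1.
Proof.
move=> femb gS2 x i px fix_i; apply: (emb_inj femb); rewrite (emb_walk femb).
apply: gS2; first by rewrite (emb_pos femb).
by rewrite -(emb_walk femb) -(emb_mate femb) fix_i.
Qed.

(** Walks in a path block keep the sign, and up to sign the start is the only point fixed by
    [mate false]. *)
Lemma good_std l : good (std l).
Proof.
elim: l => [|[m s] l IHl]; first by case.
have gB : good (block m s).
  move=> [j b] i /andP[om /andP[/eqP j0 /negbTE b0]] /eqP; rewrite /= in j0 b0; rewrite {}b0.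
  have sgn k : (walk (block m s) k (j, false)).2 = false.
    elim: k => //= k ->; rewrite step_raw_odd //.
  have wf := block_axioms m s.
  rewrite (mate_fix wf) /= om /= -andb_orr => /andP[/eqP w0 _].
  apply/eqP; rewrite -pair_eqE /= /pair_eq sgn eqxx andbT.
  by apply/eqP/val_inj; rewrite /= w0 j0.
move=> [x|x] i px.
  by rewrite -(emb_walk (embedding_inl _ _)) => -[/(gB _ _ px) ->].
by rewrite -(emb_walk (embedding_inr _ _)) => -[/(IHl _ _ px) ->].
Qed.

(** * Single matchings up to isomorphism *)

Section Doubled.

Definition doubled (T : finType) (S : bimatch T) (c : bool) : bimatch T :=
  BiMatch (opp S) (fun _ => mate S c) (fun _ => pos S c).

Lemma doubled_axioms (T : finType) (S : bimatch T) c :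
  bimatch_axioms S -> bimatch_axioms (doubled S c).
Proof.
move=> wf; split=> [||? /=|? /=|? /=|? /=|? /=].
- exact: (oppK wf).
- exact: (opp_neq wf).
- exact: (mateK wf).
- exact: (mate_opp wf).
- exact: (mate_neq_opp wf).
- exact: (mate_fix wf).
exact: (pos_opp wf).
Qed.

Lemma walk_doubled (T : finType) (S : bimatch T) c x i : bimatch_axioms S ->
  pos S c x -> walk (doubled S c) i x = x.
Proof. by move=> wf px; elim: i => //= i ->; rewrite (pos_mate wf). Qed.

Lemma good_doubled (T : finType) (S : bimatch T) c :
  bimatch_axioms S -> good (doubled S c).
Proof. by move=> wf x i px _; apply: walk_doubled. Qed.

Lemma typ_doubled (T : finType) (S : bimatch T) c m s x : bimatch_axioms S ->
  typ (doubled S c) m s x -> ((m, s) == (1, false)) || ((m, s) == (2, false)).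
Proof.
move=> wf typx; have wfd := doubled_axioms c wf.
have dist := typ_distinct false typx.
have /and3P[m_gt0 _] := typx; case: ifP => om.
  move=> /andP[/= px]; rewrite walk_doubled // => psx.
  have -> : m = 1.
    apply/eqP; rewrite eqn_leq m_gt0 andbT leqNgt; apply/negP=> lt_1m.
    by have /eqP[] := dist 0 1 isT lt_1m; rewrite !walk_doubled.
  by case: s psx {typx} => // psx; have := pos_opp wf px; rewrite psx.
have w2 : walk (doubled S c) 2 x = x by rewrite /= (mateK wf).
have -> : m = 2.
  apply/eqP; rewrite eqn_leq; apply/andP; split; last by lia.
  by rewrite leqNgt; apply/negP=> lt_2m; have /eqP[] := dist 0 2 isT lt_2m; rewrite /= mateK.
rewrite w2; case: s {typx} => // /eqP/esym/eqP.
by rewrite (negbTE (opp_neq wf x)).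
Qed.

(* A matching paired with itself has components of types (1, false) and       *)
(* (2, false) only.                                                           *)
Lemma doubled_iso (T1 T2 : finType) (S1 : bimatch T1) (S2 : bimatch T2) c1 c2 :
  bimatch_axioms S1 -> bimatch_axioms S2 -> #|T1| = #|T2| ->
  #|pos S1 c1| = #|pos S2 c2| ->
  exists f, embedding (doubled S1 c1) (doubled S2 c2) f.
Proof.
move=> wf1 wf2 eqT eq_pos.
have [l1 [typ1 card1 [f1 emb1]]] :=
  classification (doubled_axioms c1 wf1) (good_doubled wf1) erefl.
have [l2 [typ2 card2 [f2 emb2]]] :=
  classification (doubled_axioms c2 wf2) (good_doubled wf2) erefl.
have [g1 f1K [g1K gemb1]] := embedding_bij emb1 (eq_leq (esym card1)).
have [g2 f2K [g2K gemb2]] := embedding_bij emb2 (eq_leq (esym card2)).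
have two (T : finType) (S : bimatch T) c l : bimatch_axioms S -> typed (doubled S c) l ->
    all (fun p => (p == (1, false)) || (p == (2, false))) l.
  by move=> wf typ_l; apply/allP=> -[m s] /typ_l[x /(typ_doubled wf)].
have card_pos (T : finType) (S : bimatch T) c l f : #|std_type l| = #|T| ->
    embedding (std l) (doubled S c) f -> typed (doubled S c) l ->
    #|pos S c| = count (fun p => odd p.1) l.
  move=> cardT emb /typed_gt0/card_std_pos_odd <-.
  have [g fK [gK _]] := embedding_bij emb (eq_leq (esym cardT)).
  rewrite -(card_image (emb_inj emb) (pos (std l) false)); apply: eq_card => y.
  rewrite -{2}[y]gK mem_image; last exact: emb_inj emb.
  by have := emb_pos emb false (g y); rewrite gK.
have eq_odd : count (fun p => odd p.1) l1 = count (fun p => odd p.1) l2.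
  by rewrite -(card_pos _ _ _ _ _ card1 emb1 typ1) -(card_pos _ _ _ _ _ card2 emb2 typ2).
have eq_sum : sumn [seq p.1 | p <- l1] = sumn [seq p.1 | p <- l2].
  by apply/eqP; rewrite -(eqn_pmul2l (isT : 0 < 2)) -!card_std_type card1 card2 eqT.
have nums l : all (fun p => (p == (1, false)) || (p == (2, false))) l ->
    count (fun p => odd p.1) l = count (pred1 (1, false)) l /\ sumn [seq p.1 | p <- l] = count (pred1 (1, false)) l + 2 * count (pred1 (2, false)) l.
  elim: l => //= p l IHl /andP[/orP[]/eqP-> /IHl[-> ->]] /=; split; lia.
have [two1 two2] := (two _ _ _ _ wf1 typ1, two _ _ _ _ wf2 typ2).
have [[o1 s1] [o2 s2]] := (nums l1 two1, nums l2 two2).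
have eq_l : perm_eq l1 l2.
  apply/allP=> p; rewrite mem_cat => p12; apply/eqP => /=.
  have /orP[/eqP->|/eqP->] : (p == (1, false)) || (p == (2, false)).
    by case/orP: p12 => [/(allP two1)|/(allP two2)].
    by rewrite -o1 -o2.
  apply/eqP; rewrite -(eqn_pmul2l (isT : 0 < 2)).
  by rewrite -(eqn_add2l (count (pred1 (1, false)) l1)) -s1 eq_sum s2 -o1 -o2 eq_odd.
have [h hemb] := std_perm (typed_gt0 typ2) (etrans (perm_sym _ _) eq_l).
exists (f2 \o (h \o g1)).
exact: embedding_comp (embedding_comp gemb1 hemb) emb2.
Qed.

End Doubled.

(** * The product of the two matchings and half-turns of paths *)

Section Rotation.
Variables (T : finType) (S : bimatch T).
Hypothesis wf : bimatch_axioms S.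

Let rho := mate S false \o mate S true.

Lemma rho_inj : injective rho.
Proof. by apply: inj_comp; apply: can_inj (mateK wf _). Qed.

Lemma iter_rho_inj i : injective (iter i rho).
Proof. by elim: i => //= i IHi; apply: inj_comp rho_inj IHi. Qed.

Lemma iter_rho_oppb i b x : iter i rho (oppb S b x) = oppb S b (iter i rho x).
Proof. by rewrite -!walk_double walk_oppb. Qed.

(** Conjugation by either mate inverts rho, as in a dihedral group. *)
Lemma iter_rho_mateK i c x : iter i rho (mate S c (iter i rho x)) = mate S c x.
Proof.
elim: i => // i IHi; rewrite iterSr -[RHS]IHi; congr (iter i rho _).
by rewrite /= /rho /=; case: c {IHi}; rewrite ?(mateK wf).
Qed.

Lemma iter_rho_eq n x : (iter n rho x == x) = (fingraph.order rho x %| n).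
Proof.
have iter_mul k : iter (k * fingraph.order rho x) rho x = x.
  by elim: k => // k IHk; rewrite mulSn iterD IHk (iter_order rho_inj).
apply/eqP/idP=> [fix_x | /dvdnP[k ->]]; last exact: iter_mul.
rewrite /dvdn; have lt := ltn_pmod n (fingraph.order_gt0 rho x).
move: fix_x; rewrite {1}(divn_eq n (fingraph.order rho x)) addnC iterD iter_mul => fix_x.
by rewrite -(findex_iter lt) fix_x findex0.
Qed.

Lemma order_comm (f : T -> T) x : injective f -> (forall y, f (rho y) = rho (f y)) ->
  fingraph.order rho (f x) = fingraph.order rho x.
Proof.
move=> f_inj comm; have iter_f n y : iter n rho (f y) = f (iter n rho y).
  by elim: n => //= n ->; rewrite comm.
apply/eqP; rewrite eqn_dvd; apply/andP; split; rewrite -iter_rho_eq.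
  by rewrite iter_f (inj_eq f_inj) iter_rho_eq.
by rewrite -(inj_eq f_inj) -iter_f iter_rho_eq.
Qed.

(** When [mate false] fixes x, it sends rho^i x to rho^(-i) x, and [mate true] sends rho^i x to
    rho^(-i-1) x, whence [odd_fix]. *)
Lemma even_fix x i : mate S false x = x ->
  (mate S false (iter i rho x) == iter i rho x) = (iter i.*2 rho x == x).
Proof.
move=> fix_x; rewrite -(inj_eq (iter_rho_inj (i := i))) iter_rho_mateK fix_x.
by rewrite -iterD addnn eq_sym.
Qed.

Lemma odd_fix x i : mate S false x = x ->
  (mate S true (iter i rho x) == iter i rho x) = (iter i.*2.+1 rho x == x).
Proof.
move=> fix_x; rewrite -(inj_eq (iter_rho_inj (i := i.+1))).
rewrite [iter i.+1 rho (mate _ _ _)]iterS iter_rho_mateK {1}/rho /= (mateK wf) fix_x.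
by rewrite -iterS -iterD addSn addnn eq_sym.
Qed.

(** Otherwise the midpoint of the walk would be matched with its own opposite. *)
Lemma iter_rho_neq_opp x i : mate S false x = x -> iter i rho x != opp S x.
Proof.
move=> fix_x; apply/eqP=> eq_opp; have [odd_i|even_i] := boolP (odd i).
  have iE : i = (i./2).*2.+1 by lia.
  have /eqP[] := mate_neq_opp wf true (iter i./2 rho x).
  apply: (iter_rho_inj (i := (i./2).+1)).
  rewrite [LHS]iterS iter_rho_mateK {1}/rho /= (mateK wf) fix_x.
  rewrite -[opp S _]/(oppb S true _) -iterS iter_rho_oppb -iterD addSn addnn -iE eq_opp.
  by rewrite /= (oppK wf).
have iE : i = (i./2).*2 by lia.
have /eqP[] := mate_neq_opp wf false (iter i./2 rho x).
apply: (iter_rho_inj (i := i./2)); rewrite iter_rho_mateK fix_x.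
rewrite -[opp S _]/(oppb S true _) iter_rho_oppb -iterD addnn -iE eq_opp.
by rewrite /= (oppK wf).
Qed.

(* If x and y = rho ^ k x are both fixed by mate false, the component of x is *)
(* a path from x to +-y, and +-rho ^ k reverses it.                           *)
Lemma half_turn x k : pos S false x ->
  mate S false (iter k rho x) = iter k rho x -> iter k rho x <> x ->
  exists2 f, embedding S S f & exists y,
    [/\ y != x, pos S false y, f x = y, f y = x
      & (forall z, pos S false z -> z != x -> z != y -> f z = z) /\
        (forall z, pos S true z -> f z = z)].
Proof.
move=> px fix_k neq_k; have fix_x := pos_mate wf px.
have [s py] : exists s, pos S false (oppb S s (iter k rho x)).
  have := mate_fix wf false (iter k rho x); rewrite fix_k eqxx.
  by case/esym/orP=> p; [exists false | exists true].
set y := oppb S s _ in py.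
pose m := fingraph.order rho x.
have m_dvd n : (iter n rho x == x) = (m %| n) := iter_rho_eq n x.
have dvd_2k : m %| k.*2 by rewrite -m_dvd -even_fix // fix_k.
have ndvd_k : ~~ (m %| k) by rewrite -m_dvd; apply/eqP.
have even_m : ~~ odd m.
  apply: contra ndvd_k => odd_m; move: dvd_2k; rewrite -mul2n Gauss_dvdr //.
  by rewrite coprimen2.
(* The component of x: up to sign, a single orbit of rho. *)
pose C := [pred z | [exists j : 'I_m, (z == iter j rho x) || (z == opp S (iter j rho x))]].
have CP z : reflect (exists j b, z = oppb S b (iter j rho x)) (z \in C).
  apply: (iffP existsP) => [[j /orP[]/eqP->] | [j [b ->]]].
  - by exists j, false.
  - by exists j, true.
  have m_gt0 : 0 < m := fingraph.order_gt0 rho x.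
  exists (Ordinal (ltn_pmod j m_gt0)) => /=.
  have -> : iter (j %% m) rho x = iter j rho x.
    rewrite [in RHS](divn_eq j m) addnC iterD; congr (iter _ rho _); apply/esym/eqP.
    by rewrite m_dvd dvdn_mull.
  by case: b; rewrite eqxx ?orbT.
have Copp z : (opp S z \in C) = (z \in C).
  have Cimp u : u \in C -> opp S u \in C.
    case/CP=> j [b ->]; apply/CP; exists j, (~~ b).
    by rewrite -[opp S _]/(oppb S true _) oppbD.
  by apply/idP/idP=> /Cimp; rewrite ?(oppK wf).
have Crho z : z \in C -> rho z \in C.
  case/CP=> j [b ->]; apply/CP; exists j.+1, b.
  by rewrite -[rho _]/(iter 1 rho _) iter_rho_oppb.
have Cmate0 z : z \in C -> mate S false z \in C.
  case/CP=> j [b ->]; rewrite (mate_oppb wf); apply/CP.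
  exists (j * m.-1), b; congr (oppb S b _); apply: (iter_rho_inj (i := j)).
  rewrite iter_rho_mateK fix_x -iterD -mulnS prednK ?fingraph.order_gt0 //.
  by apply/esym/eqP; rewrite m_dvd dvdn_mull.
have Cmate c z : (mate S c z \in C) = (z \in C).
  have Cimp u : u \in C -> mate S c u \in C.
    case: c => [|/Cmate0 //] /Crho/Cmate0; by rewrite /rho /= (mateK wf).
  by apply/idP/idP=> /Cimp; rewrite ?(mateK wf).
have C_2k z : z \in C -> iter k.*2 rho z = z.
  case/CP=> j [b ->]; rewrite iter_rho_oppb -iterD addnC iterD; congr (oppb S b (iter j rho _)).
  by apply/eqP; rewrite m_dvd.
have xC : x \in C by apply/CP; exists 0, false.
have yC : y \in C by apply/CP; exists k, s.
(* An end of [mate false] at exponent j has m dividing 2j, so j is 0 or k modulo m. *)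
have pos0C z : z \in C -> pos S false z -> z = x \/ z = y.
  case/CP=> j [b ->] pz; have : m %| j.*2.
    rewrite -m_dvd -even_fix //; apply/eqP/(oppb_inj wf (b := b)).
    by rewrite -(mate_oppb wf) pos_mate.
  have pos_inj u v d e : oppb S d u = oppb S e v -> pos S false u -> pos S false v -> u = v.
    move=> eq_uv pu pv; have : u = oppb S (d (+) e) v by rewrite -(oppbD wf) -eq_uv oppbK.
    by case: (d (+) e) => //= eq_u; have := pos_opp wf pv; rewrite -eq_u pu.
  move=> dvd_2j; have [m_j|nm_j] := boolP (m %| j).
    by left; apply: (pos_inj _ _ b false) => //; rewrite oppbK //; apply/eqP; rewrite m_dvd.
  right; apply: (pos_inj _ _ b s) => //; rewrite !oppbK //.
  have : m %| j + k.
    move: dvd_2k dvd_2j ndvd_k nm_j.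
    have mE : m = 2 * m./2 by rewrite mul2n; lia.
    rewrite mE -!mul2n !dvdn_pmul2l // => /dvdnP[a ->] /dvdnP[c ->].
    have h_gt0 : 0 < m./2 by have := fingraph.order_gt0 rho x; rewrite -/m; lia.
    by rewrite -mulnDl !dvdn_pmul2r // !dvdn2; lia.
  have : iter k rho (iter k rho x) = x by rewrite -iterD addnn C_2k.
  move=> e2k /dvdnP[a jk]; apply: (iter_rho_inj (i := k)); rewrite e2k -iterD addnC jk.
  by apply/eqP; rewrite m_dvd dvdn_mull.
(* An end of [mate true] would make the even number m divide an odd one. *)
have pos1C z : pos S true z -> z \notin C.
  move=> pz; apply/CP=> -[j [b zE]]; have : m %| j.*2.+1.
    rewrite -m_dvd -odd_fix //; apply/eqP/(oppb_inj wf (b := b)).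
    by rewrite -(mate_oppb wf) -zE pos_mate.
  move/dvdnP=> [a jE]; move: even_m (congr1 odd jE).
  by rewrite /= odd_double oddM => /negbTE->; rewrite andbF.
have neq_yx : y != x.
  rewrite /y; case: (s) => /=; last exact/eqP.
  apply: contra (iter_rho_neq_opp k fix_x) => /eqP eq_x.
  by rewrite -[X in opp S X]eq_x (oppK wf).
(* The half-turn of the component, with the sign that sends x to the positive end y. *)
pose f z := if z \in C then oppb S s (iter k rho z) else z.
have fx : f x = y by rewrite /f xC.
have fC z : (f z \in C) = (z \in C).
  rewrite /f; case: ifP => // zC; have /CP[j [b ->]] := zC.
  by apply/CP; exists (k + j), (s (+) b); rewrite iter_rho_oppb oppbD // iterD.
have fK : involutive f.
  move=> z; rewrite {1}/f fC; case: ifP => zC; last by rewrite /f zC.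
  by rewrite /f zC iter_rho_oppb oppbK // -iterD addnn C_2k.
have fy : f y = x by rewrite -fx fK.
have fmate c z : f (mate S c z) = mate S c (f z).
  rewrite /f Cmate; case: ifP => // zC; rewrite (mate_oppb wf); congr (oppb S s _).
  apply: (iter_rho_inj (i := k)); rewrite iter_rho_mateK -iterD addnn C_2k //.
  by rewrite Cmate.
have f_id z : z \notin C -> f z = z by rewrite /f => /negbTE->.
have fpos0 z : pos S false z -> pos S false (f z).
  move=> pz; have [zC|/f_id-> //] := boolP (z \in C).
  by have [->|->] := pos0C z zC pz; rewrite ?fx ?fy.
exists f.
  split; [exact: inv_inj | | by [] | ].
    move=> z; rewrite /f Copp; case: ifP => // _.
    by rewrite -[opp S z]/(oppb S true z) iter_rho_oppb -oppb_opp.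
  case=> z; last by apply/idP/idP => [/fpos0|/fpos0 //]; rewrite fK.
  have [zC|/f_id-> //] := boolP (z \in C).
  by apply/idP/idP=> /pos1C; rewrite ?fC zC.
exists y; split=> //; split=> [z pz zx zy|z /pos1C/f_id //].
by apply: f_id; apply/negP=> /pos0C/(_ pz)[]/eqP; apply/negP.
Qed.

(* On a path with m points rho has order m, and for m odd the half-turn       *)
(* rho ^ m./2 maps one end to the other, up to sign.                          *)
Definition far_end (x : T) : T :=
  let y := iter (fingraph.order rho x)./2 rho x in
  if pos S true y then y else opp S y.

Lemma far_end_emb f x : embedding S S f -> far_end (f x) = f (far_end x).
Proof.
move=> femb; have comm y : f (rho y) = rho (f y) by rewrite /rho /= !(emb_mate femb).
rewrite /far_end order_comm //; last exact: emb_inj femb.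
have -> i : iter i rho (f x) = f (iter i rho x) by elim: i => //= i ->; rewrite comm.
by rewrite (emb_pos femb); case: ifP => // _; rewrite (emb_opp femb).
Qed.

Hypothesis gS : good S.

(** For an even order m, rho^(m/2) x would be a second point fixed by [mate false], which [good]
    forbids. *)
Lemma odd_order_good x : pos S false x -> odd (fingraph.order rho x).
Proof.
move=> px; set m := fingraph.order rho x; apply: negbNE; apply/negP=> even_m.
have m_gt0 : 0 < m := fingraph.order_gt0 rho x.
have mE : m = (m./2).*2 by lia.
have fix_x := pos_mate wf px.
have := gS (i := m./2) px; rewrite walk_double -/rho => stays.
have /eqP : iter m./2 rho x == x.
  apply/eqP/stays/eqP; rewrite even_fix // -mE iter_rho_eq //.
by move/eqP; rewrite iter_rho_eq -/m => /dvdn_leq; lia.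
Qed.

Lemma far_end_pos x : pos S false x -> pos S true (far_end x).
Proof.
move=> px; rewrite /far_end; case: ifP => // npos.
set m := fingraph.order rho x in npos *; have odd_m : odd m := odd_order_good px.
have : mate S true (iter m./2 rho x) == iter m./2 rho x.
  rewrite odd_fix ?(pos_mate wf) // iter_rho_eq -/m.
  by have -> : (m./2).*2.+1 = m by lia.
by rewrite (mate_fix wf) npos.
Qed.

(** rho has the same order at x and at its far end, so equal far ends come from the same power of
    rho; the sources agree up to sign, and both are positive. *)
Lemma far_end_inj : {in pos S false &, injective far_end}.
Proof.
move=> x x' px px'.
have far_endE z : exists b, far_end z = oppb S b (iter (fingraph.order rho z)./2 rho z).
  by rewrite /far_end; case: ifP => _; [exists false | exists true].
have orderE z : fingraph.order rho (far_end z) = fingraph.order rho z.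
  have [b ->] := far_endE z.
  rewrite (@order_comm (oppb S b)); first last.
  - by move=> y; rewrite -[rho _]/(iter 1 rho _) -iter_rho_oppb.
  - exact: oppb_inj.
  rewrite (@order_comm (iter _ rho)) //; first exact: iter_rho_inj.
  by move=> y; rewrite -iterSr.
move=> eq_far; have eq_order := congr1 (fingraph.order rho) eq_far.
rewrite !orderE in eq_order.
have [[b xE] [b' xE']] := (far_endE x, far_endE x').
move: eq_far; rewrite xE xE' eq_order => /(congr1 (oppb S b)).
rewrite oppbK // oppbD // -iter_rho_oppb => /iter_rho_inj.
case: (b (+) b') => //= eq_x; have := pos_opp wf (px' : pos S false x').
by rewrite -eq_x (px : pos S false x).
Qed.

End Rotation.

(** * Double cosets in the signed permutation group *)

Section BaseMatching.
Variables (n k : nat).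
Hypothesis le_kn : 2 * k <= n.
Local Notation V := (spoint n).

Definition partner_raw (i : nat) : nat :=
  if i < 2 * k then (if odd i then i.-1 else i.+1) else i.

Lemma partner_raw_lt i : i < n -> partner_raw i < n.
Proof. by rewrite /partner_raw; do !case: ifP; lia. Qed.

Lemma partner_rawK : involutive partner_raw.
Proof. by move=> i; rewrite /partner_raw; do !case: ifP; lia. Qed.

Definition partner_ord (i : 'I_n) : 'I_n := Ordinal (partner_raw_lt (ltn_ord i)).

Lemma partner_ordK : involutive partner_ord.
Proof. by move=> i; apply: val_inj; apply: partner_rawK. Qed.

Definition partner : {perm 'I_n} := perm (can_inj partner_ordK).

Lemma partnerE i : partner i = partner_ord i. Proof. exact: permE. Qed.

Definition base_match : {perm V} := sperm partner.

Lemma base_matchE (x : V) : base_match x = (partner_ord x.1, x.2).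
Proof. by rewrite permE partnerE. Qed.

Lemma base_matchK : involutive base_match.
Proof. by move=> x; rewrite !base_matchE /= partner_ordK -surjective_pairing. Qed.

Definition base_pos : {set V} := [set x : V | (2 * k <= x.1) && ~~ x.2].

Definition base : bimatch V :=
  BiMatch (@spoint_opp n) (fun _ => base_match) (fun _ x => x \in base_pos).

Lemma base_axioms : bimatch_axioms base.
Proof.
split=> [x|x|c|c x|c x|c x|c x] /=.
- by case: x => i b; rewrite /spoint_opp /= negbK.
- by rewrite -pair_eqE /= /pair_eq /=; case: x.2; rewrite andbF.
- exact: base_matchK.
- by rewrite !base_matchE.
- by rewrite base_matchE -pair_eqE /= /pair_eq /=; case: x.2; rewrite andbF.
- rewrite base_matchE !inE -pair_eqE /= /pair_eq /= eqxx andbT negbK -andb_orr orNb andbT.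
  by rewrite -val_eqE /= /partner_raw; case: ifP; [case: ifP|]; lia.
by rewrite !inE /= => /andP[-> /negbTE->].
Qed.

Lemma card_base_pos : #|base_pos| = n - 2 * k.
Proof.
have -> : base_pos = [set (i, false) | i in [set i : 'I_n | 2 * k <= i]].
  apply/setP=> -[i b]; rewrite !inE /=; apply/andP/imsetP => [[le_i /negbTE->]|[j le_j [-> ->]]].
    by exists i; rewrite ?inE.
  by rewrite inE in le_j.
rewrite card_imset => [|i j []//]; rewrite cardsE -sum1_card.
rewrite -(big_mkord (fun i => 2 * k <= i) (fun=> 1)) (big_cat_nat (n := 2 * k)) //=.
rewrite big_nat_cond big_pred0 => [|i]; last by apply/negP; lia.
rewrite add0n big_nat_cond (eq_bigl (fun i => (2 * k <= i < n) && true)) => [|i]; last by lia.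
by rewrite -big_nat_cond sum_nat_const_nat muln1.
Qed.

(** The stabilizer of the base signed matching, an intrinsic description of H_(k,q) that replaces
    its generators. *)
Definition stab : {group {perm V}} :=
  ('C_(B n)[base_match] :&: 'N(base_pos | 'P))%G.

Lemma stabP w : reflect
  [/\ w \in B n, forall x, w (base_match x) = base_match (w x)
    & forall x, (w x \in base_pos) = (x \in base_pos)]
  (w \in stab).
Proof.
apply: (iffP setIP) => [[/setIP[wB /cent1P cw] nw] | [wB cw nw]].
  split=> // x; last exact: (astabsP nw).
  by have /permP/(_ x) := cw; rewrite !permM.
split; last by apply/astabsP.
by apply/setIP; split=> //; apply/cent1P/permP=> x; rewrite !permM.
Qed.

Lemma sperm_in_B (s : {perm 'I_n}) : sperm s \in B n.
Proof. by apply/in_B=> x; rewrite !permE. Qed.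

Lemma swap_base (i j : 'I_n) : ((swap i j) ^ base_match)%g = swap (partner i) (partner j).
Proof. by rewrite /base_match /swap -morphJ ?inE // tpermJ. Qed.

Lemma flip_in_B (i : 'I_n) : flip i \in B n.
Proof.
apply/cent1P; rewrite /commute conjgC tpermJ; congr (_ * _)%g.
by rewrite tpermC; congr (tperm _ _); rewrite permE.
Qed.

Lemma flip_base (i : 'I_n) : ((flip i) ^ base_match)%g = flip (partner i).
Proof. by rewrite tpermJ; congr (tperm _ _); rewrite base_matchE /= partnerE. Qed.

Lemma commute_flip (i j : 'I_n) : commute (flip i) (flip j).
Proof.
have [-> //|neq] := eqVneq i j.
apply/commgP/conjg_fixP; rewrite tpermJ !tpermD // -pair_eqE /= /pair_eq /= ?(eq_sym j) (negbTE neq) //.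
Qed.

Lemma blocksP (p : 'I_n * 'I_n) : p \in blocks n k ->
  [/\ ~~ odd p.1, p.2 = p.1.+1 :> nat, p.2 < 2 * k, partner p.1 = p.2 & partner p.2 = p.1].
Proof.
rewrite inE => /and3P[ev /eqP p2 lt]; split=> //; rewrite partnerE; apply: val_inj => /=;
  rewrite /partner_raw; do !case: ifP; lia.
Qed.

Lemma mem_stab_cent w : w \in B n -> (w ^ base_match)%g = w ->
  (forall x, x \in base_pos -> w x \in base_pos) -> w \in stab.
Proof.
move=> wB cw nw; apply/setIP; split; last first.
  by rewrite !inE /=; apply/subsetP=> x xP; rewrite inE; apply: nw.
by apply/setIP; split=> //; apply/cent1P; rewrite /commute conjgC cw.
Qed.

Lemma Ck_sub_stab : Ck n k \subset stab.
Proof.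
have headfix w : w \in perm.Sym (headpts n (2 * k)) ->
    forall x, x \in base_pos -> w x \in base_pos.
  rewrite inE => Sw x xP; rewrite (out_perm Sw) //; move: xP; rewrite !inE => /andP[le _].
  by rewrite -leqNgt.
have CS := subsetP (Ck_sub_Sym n k).
rewrite gen_subG; apply/subsetP=> w wgen.
apply: mem_stab_cent; last exact: headfix (CS _ (mem_gen wgen)).
  case/setUP: wgen => [/setUP[]|].
  - by case/imsetP=> p _ ->; apply: sperm_in_B.
  - by case/imsetP=> p _ ->; rewrite groupM ?flip_in_B.
  by case/imset2P=> p r _ _ ->; rewrite groupM ?sperm_in_B.
case/setUP: wgen => [/setUP[]|].
- by case/imsetP=> p /blocksP[_ _ _ p1 p2] ->; rewrite swap_base p1 p2 /swap tpermC.
- case/imsetP=> p /blocksP[_ _ _ p1 p2] ->; rewrite conjMg !flip_base p1 p2.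
  exact: commute_flip.
case/imset2P=> p r /blocksP[ep p2E _ p1 p2]; rewrite inE => /andP[/blocksP[er r2E _ r1 r2] /eqP rp] ->.
rewrite conjMg !swap_base p1 p2 r1 r2 /swap -!morphM ?inE //; congr (sperm _).
apply/commgP/conjg_fixP; rewrite tpermJ !tpermD // -val_eqE /=; lia.
Qed.

Lemma Stail_sub_stab : Stail n (2 * k) \subset stab.
Proof.
apply/subsetP=> _ /morphimP[s _ Ss ->]; rewrite inE in Ss.
apply: mem_stab_cent; first exact: sperm_in_B.
  rewrite /base_match -morphJ ?inE //; congr (sperm _); apply/conjg_fixP/commgP.
  apply: (perm_onC (S1 := tailset n (2 * k)) (S2 := ~: tailset n (2 * k))) => //.
    apply/subsetP=> i; rewrite !inE partnerE -val_eqE /= /partner_raw -ltnNge.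
    by case: ifP; rewrite // eqxx.
  by rewrite disjoints_subset setCK.
move=> [i b]; rewrite !inE permE /= => /andP[le_i ->]; rewrite andbT.
by have := perm_closed i Ss; rewrite !inE le_i.
Qed.

Lemma Hk_sub_stab : Hk n k \subset stab.
Proof. by rewrite join_subG Ck_sub_stab Stail_sub_stab. Qed.

(** The c_i change signs, the a_i exchange the two coordinates of a block and the b_i carry a block
    to the next one. *)
Lemma Ck_moves (r : nat) (rk : r < k) (y : V) : y.1 < 2 * r + 2 ->
  exists u, [/\ u \in Ck n k, forall x : V, 2 * r + 2 <= x.1 -> u x = x
    & val (u y).1 = 2 * r /\ (u y).2 = false].
Proof.
have ltn i : i < 2 * k -> i < n by move=> lt; apply: leq_trans le_kn.
have blk (i : nat) (lt : i.+1 < 2 * k) : ~~ odd i ->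
    (Ordinal (ltn i (ltnW lt)), Ordinal (ltn i.+1 lt)) \in blocks n k.
  by move=> ev; rewrite inE /= ev eqxx.
have swapE (i j : 'I_n) (x : V) : swap i j x = (tperm i j x.1, x.2) by rewrite permE.
pose good_move y := exists u, [/\ u \in Ck n k, forall x : V, 2 * r + 2 <= x.1 -> u x = x
    & val (u y).1 = 2 * r /\ (u y).2 = false].
have step v z : v \in Ck n k -> (forall x : V, 2 * r + 2 <= x.1 -> v x = x) ->
    good_move (v z) -> good_move z.
  move=> vC vfix [u [uC ufix uz]]; exists (v * u)%g; split; first exact: groupM.
    by move=> x le_x; rewrite permM vfix // ufix.
  by rewrite permM.
have neq_pt (i : 'I_n) b (x : V) : i != x.1 :> nat -> (i, b) != x.
  by apply: contraNneq => <-.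
have lt_neq (i j : 'I_n) : i < j -> i != j by move=> lt_ij; apply: contraTneq lt_ij => ->; rewrite ltnn.
have neq_ord (i j : 'I_n) : i != j :> nat -> i != j by apply: contraNneq => ->.
suffices even_pos d (i : 'I_n) : ~~ odd i -> i + 2 * d = 2 * r -> good_move (i, false).
  move=> lt_y; rewrite -/(good_move y).
  have even_case (i : 'I_n) b : ~~ odd i -> i < 2 * r + 2 -> good_move (i, b).
    move=> ev lt_i; have {}even_pos : good_move (i, false) by apply: (even_pos (r - i./2)); lia.
    case: b => //; have lt : i.+1 < 2 * k by lia.
    have := blk i lt ev; set p := (_, _) => pb.
    have [p1 p2] : p.1 = i :> nat /\ p.2 = i.+1 :> nat by [].
    have {}p1 : p.1 = i by exact: val_inj.
    move: (p) pb p1 p2 => {}p pb p1 p2.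
    apply: (step (flip p.1 * flip p.2)%g).
    - by apply: mem_gen; rewrite !inE; apply/orP; left; apply/orP; right; apply: imset_f.
    - by move=> x le_x; rewrite permM p1 !tpermD //; apply: neq_pt; lia.
    have -> // : (flip p.1 * flip p.2)%g (i, true) = (i, false).
    by rewrite permM p1 tpermR tpermD //; apply: neq_pt => /=; lia.
  suffices all_pos (i : 'I_n) (b : bool) : i < 2 * r + 2 -> good_move (i, b).
    by rewrite [y]surjective_pairing; apply: all_pos.
  move=> lt_i; have [od|ev] := boolP (odd i); last exact: even_case.
  have lt : i.-1.+1 < 2 * k by lia.
  have := blk i.-1 lt; set p := (_, _) => pb; have {}pb : p \in blocks n k by apply: pb; lia.
  have [p1 p2] : p.1 = i.-1 :> nat /\ p.2 = i.-1.+1 :> nat by [].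
  have {}p2 : p.2 = i by apply: val_inj => /=; lia.
  move: (p) pb p1 p2 => {}p pb p1 p2.
  apply: (step (swap p.1 p.2)).
  - by apply: mem_gen; rewrite !inE; apply/orP; left; apply/orP; left; apply: imset_f.
  - by move=> x le_x; rewrite p2 swapE tpermD -?surjective_pairing //; apply: neq_ord; lia.
  by rewrite swapE /= p2 tpermR; apply: even_case => /=; lia.
(* Here d is the number of blocks still to be crossed, one b_i for each. *)
elim: d i => [|d IHd] i ev eq_i.
  exists 1%g; split=> // [x _|]; rewrite perm1 //=; lia.
have lt1 : i.+1 < 2 * k by lia.
have lt3 : i.+2.+1 < 2 * k by lia.
have := blk i lt1 ev; set p := (_, _) => pb.
have := blk i.+2 lt3; set p' := (_, _) => pb'; have {}pb' : p' \in blocks n k by apply: pb'; lia.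
have [p1 p2] : p.1 = i :> nat /\ p.2 = i.+1 :> nat by [].
have {}p1 : p.1 = i by exact: val_inj.
have [p1' p2'] : p'.1 = i.+2 :> nat /\ p'.2 = i.+2.+1 :> nat by [].
move: (p) (p') pb pb' p1 p2 p1' p2' => {}p {}p' pb pb' p1 p2 p1' p2'.
apply: (step (swap p.1 p'.1 * swap p.2 p'.2)%g).
- apply: mem_gen; rewrite !inE; apply/orP; right; apply/imset2P; exists p p' => //.
  by apply/setIdP; split; rewrite // p1' p2.
- by move=> x le_x; rewrite p1 permM !swapE /= !tpermD -?surjective_pairing //;
     apply: lt_neq; apply: leq_trans le_x; lia.
have -> : (swap p.1 p'.1 * swap p.2 p'.2)%g (i, false) = (p'.1, false).
  by rewrite permM !swapE /= p1 tpermL tpermD //; apply: neq_ord => /=; lia.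
by apply: IHd => /=; lia.
Qed.

Lemma stab_head_fixed h : h \in stab -> (forall x : V, x.1 < 2 * k -> h x = x) ->
  h \in Stail n (2 * k).
Proof.
case/stabP=> /in_B hB hC hP hfix.
have hE i b : h (i, b) = ((h (i, false)).1, b).
  have hfalse : (h (i, false)).2 = false.
    have [lt|le] := ltnP i (2 * k); first by rewrite hfix.
    have := hP (i, false); rewrite !inE le /= => /andP[_].
    by case: (_.2).
  case: b; last by rewrite [LHS]surjective_pairing hfalse.
  by rewrite -[(i, true)]/(spoint_opp (i, false)) hB /spoint_opp hfalse.
have s_inj : injective (fun i => (h (i, false)).1).
  move=> i j eq_ij; have : h (i, false) = h (j, false) by rewrite hE eq_ij -hE.
  by move/perm_inj=> [].
have -> : h = sperm (perm s_inj) by apply/permP=> -[i b]; rewrite permE /= permE hE.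
apply: mem_morphim; rewrite ?inE //.
apply/subsetP=> i; rewrite !inE permE; apply: contraR; rewrite -ltnNge => lt.
by rewrite hfix.
Qed.

(** Multiplying by elements of [Ck] fixes the blocks one at a time, from the last to the first; what
    remains permutes the tail without signs. *)
Lemma stab_sub_Hk : stab \subset Hk n k.
Proof.
have CH := subsetP (joing_subl (Ck n k) (Stail n (2 * k))).
have SH := subsetP (joing_subr (Ck n k) (Stail n (2 * k))).
suffices fixed_from r : r <= k -> forall h, h \in stab ->
    (forall x : V, 2 * r <= x.1 -> x.1 < 2 * k -> h x = x) -> h \in Hk n k.
  by apply/subsetP=> h hS; apply: (fixed_from k) => // x; lia.
elim: r => [_ h hS hfix | r IHr lt_rk h hS hfix].
  by apply/SH/stab_head_fixed => // x; apply: hfix.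
have lt_n : 2 * r < n by lia.
pose x0 : V := (Ordinal lt_n, false).
have /stabP[_ hC hP] := hS.
(* The image of x0 is neither in the tail, where [base_match] is trivial, nor in a block that h
   already fixes pointwise. *)
have y_lt : (h x0).1 < 2 * r + 2.
  rewrite ltnNge; apply/negP=> le_y.
  have lt_y : (h x0).1 < 2 * k.
    have : base_match (h x0) != h x0.
      rewrite -hC (inj_eq perm_inj) base_matchE -pair_eqE /= /pair_eq /= eqxx andbT -val_eqE /=.
      by rewrite /partner_raw; case: ifP; [case: ifP|]; lia.
    rewrite base_matchE -pair_eqE /= /pair_eq /= eqxx andbT -val_eqE /=.
    by rewrite /partner_raw; case: ifP; rewrite ?eqxx.
  have : h (h x0) = h x0 by apply: hfix; lia.
  move/perm_inj=> eq_x0; move: le_y; rewrite eq_x0 /=; lia.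
have [u [uC ufix [uy1 uy2]]] := Ck_moves lt_rk y_lt.
have uS := subsetP Ck_sub_stab _ uC.
suffices : (h * u)%g \in Hk n k by rewrite (groupMr _ (CH _ uC)).
apply: IHr; [exact: ltnW | exact: groupM |].
have hux0 : (h * u)%g x0 = x0.
  by rewrite permM [LHS]surjective_pairing uy2; congr (_, _); apply: val_inj.
have /stabP[/in_B huB huC _] : (h * u)%g \in stab by rewrite groupM.
have hux0' : (h * u)%g (base_match x0) = base_match x0 by rewrite huC hux0.
have fixb (y : V) : (h * u)%g y = y -> forall b, (h * u)%g (y.1, b) = (y.1, b).
  move=> fix_y b; have [<-|neq] := eqVneq y.2 b; first by rewrite -surjective_pairing.
  have -> : (y.1, b) = spoint_opp y by rewrite /spoint_opp; case: (y.2) b neq => -[].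
  by rewrite huB fix_y.
move=> [i b] /= le_i lt_i; have [le_i'|lt_i'] := leqP (2 * r + 2) i.
  by rewrite permM hfix ?ufix //=; lia.
have [i_r|i_r] : i = 2 * r :> nat \/ i = (2 * r).+1 :> nat by lia.
  have -> : i = x0.1 by apply: val_inj.
  exact: fixb.
have -> : i = (base_match x0).1; last exact: fixb.
rewrite base_matchE; apply: val_inj => /=; rewrite /partner_raw ifT; last by lia.
by rewrite ifN //; lia.
Qed.

Lemma Hk_stab : Hk n k = stab :> {set _}.
Proof. by apply/eqP; rewrite eqEsubset Hk_sub_stab stab_sub_Hk. Qed.

End BaseMatching.

(** Along an injection, a product of transpositions for s becomes one of the same length for s'. *)
Lemma odd_perm_embed (T T' : finType) (f : T -> T') (s : {perm T}) (s' : {perm T'}) :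
  injective f -> (forall x, s' (f x) = f (s x)) ->
  (forall y, y \notin codom f -> s' y = y) -> odd_perm s' = odd_perm s.
Proof.
move=> f_inj; have [ts -> dts] := prod_tpermP s.
elim: ts dts s' => [_ | [a b] ts IHts /= /andP[neq_ab dts]] s' s'f s'id.
  have -> : s' = 1%g; last by rewrite big_nil !odd_perm1.
  apply/permP=> y; rewrite perm1; have [/codomP[x ->]|/s'id //] := boolP (y \in codom f).
  by rewrite s'f big_nil perm1.
rewrite big_cons odd_permM odd_tperm neq_ab -(IHts dts (tperm (f a) (f b) * s')%g).
- by rewrite odd_permM odd_tperm (inj_eq f_inj) neq_ab addbA addbb.
- move=> x; rewrite permM.
  have -> : tperm (f a) (f b) (f x) = f (tperm a b x) by rewrite inj_tperm.
  by rewrite s'f big_cons permM tpermK.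
move=> y yf; rewrite permM tpermD ?s'id //; apply: contraNneq yf => <-; exact: codom_f.
Qed.

Fact sgn_repr (T : finType) (G : {group {perm T}}) :
  mx_repr G (fun s : {perm T} => ((-1) ^+ odd_perm s)%:M : 'M[algC]_1)%R.
Proof.
split=> [|s t _ _]; first by rewrite odd_perm1 expr0.
by rewrite odd_permM signr_addb scalar_mxM.
Qed.

Lemma cfsgn_lin (T : finType) (G : {group {perm T}}) : cfsgn G \is a linear_char.
Proof.
have -> : cfsgn G = cfRepr (MxRepresentation (sgn_repr G)).
  by apply/cfun_inP=> s sG; rewrite !cfunE sG /= mxtrace_scalar.
by rewrite qualifE /= cfRepr_char cfRepr1 eqxx.
Qed.

Lemma cfsgn_tail_lin n m : cfsgn_tail n m \is a linear_char.
Proof. by rewrite cfIsom_lin_char cfsgn_lin. Qed.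

Section Sign.
Variables (n k : nat).
Hypothesis le_kn : 2 * k <= n.
Local Notation P0 := (base_pos n k).

Lemma sign_restr_tail s : s \in perm.Sym (tailset n (2 * k)) ->
  odd_perm (restr_perm P0 (sperm s)) = odd_perm s.
Proof.
move=> Ss; have /(subsetP (Stail_sub_stab le_kn))/setIP[_ nP] : sperm s \in Stail n (2 * k).
  by rewrite mem_morphim // inE.
rewrite inE in Ss; apply: (odd_perm_embed (f := fun i => (i, false))) => [i j [] // | i | y yf].
  have [le_i | lt_i] := leqP (2 * k) i.
    have iP : (i, false) \in P0 by rewrite inE /= le_i.
    by rewrite (restr_permE nP iP) permE.
  have iP : (i, false) \notin P0 by rewrite inE /= leqNgt lt_i.
  rewrite (out_perm (restr_perm_on P0 _) iP).
  by rewrite (out_perm Ss) // inE -ltnNge.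
apply: (out_perm (restr_perm_on P0 _)); rewrite inE negb_and negbK.
apply/orP; right; case: y yf => i [] //= /negP[]; exact: codom_f.
Qed.

(** [Ck] fixes [base_pos] pointwise, and the tail group acts there as on its coordinates. *)
Lemma lambdakE h : h \in Hk n k ->
  (lambdak n k h = (-1) ^+ odd_perm (restr_perm P0 h))%R.
Proof.
move=> hH; have [_ mulH _ _] := dprodP (Hk_dprod n k).
have : h \in (Ck n k * Stail n (2 * k))%g by rewrite mulH.
case/mulsgP=> c s cC sS hE.
have NP w : w \in stab le_kn -> w \in ('N(P0 | 'P))%g by case/setIP.
have cN := NP _ (subsetP (Ck_sub_stab le_kn) _ cC).
have sN := NP _ (subsetP (Stail_sub_stab le_kn) _ sS).
rewrite hE /lambdak. rewrite (cfDprodE _ _ _ cC sS). rewrite cfun1E cC mul1r. have -> : restr_perm P0 (c * s) = (restr_perm P0 c * restr_perm P0 s)%g by exact: morphM. 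
have -> : restr_perm P0 c = 1%g.
  apply/permP=> x; rewrite perm1; have [xP|xP] := boolP (x \in P0).
    rewrite restr_permE //; have := subsetP (Ck_sub_Sym n k) _ cC; rewrite inE => Sc.
    by rewrite (out_perm Sc) // inE -leqNgt; move: xP; rewrite inE => /andP[].
  exact: (out_perm (restr_perm_on P0 _)).
rewrite mul1g; case/morphimP: sS => s0 _ s0S sE.
rewrite sE sign_restr_tail //. 
have -> : cfsgn_tail n (2 * k) (sperm s0) = cfsgn (perm.Sym (tailset n (2 * k))) s0.
  exact: (cfIsomE (Stail_isom n (2 * k)) _ s0S).
by rewrite cfunE s0S.
Qed.

Lemma lambdak_lin : lambdak n k \is a linear_char.
Proof. exact: cfDprod_lin_char (cfun1_lin_char _) (cfsgn_tail_lin _ _). Qed.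

Lemma lambdak_real : {in Hk n k, forall h, lambdak n k h^-1%g = lambdak n k h}.
Proof.
move=> h hH; rewrite lin_charV ?lambdak_lin // lambdakE //.
by rewrite -signr_odd oddb; case: odd_perm; rewrite ?invrN ?invr1.
Qed.

End Sign.

(** * Double cosets as isomorphism classes of pairs of matchings *)

Section PairsOfMatchings.
Variables (n k : nat).
Hypothesis le_kn : 2 * k <= n.
Local Notation V := (spoint n).
Local Notation P0 := (base_pos n k).
Local Notation t0 := (base_match le_kn).
Local Notation H := (Hk n k).
Local Notation lam := (lambdak n k).

Lemma HkP w : reflect
  [/\ w \in B n, forall x, w (t0 x) = t0 (w x) & forall x, (w x \in P0) = (x \in P0)]
  (w \in H).
Proof.
have -> : (w \in H) = (w \in stab le_kn) by rewrite -!topredE /= (Hk_stab le_kn).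
exact: stabP.
Qed.

Lemma Hk_sub_B : H \subset B n.
Proof. by apply/subsetP=> w /HkP[]. Qed.

(** The base matching together with its image under g. *)
Definition matching_pair (g : {perm V}) : bimatch V := BiMatch
  (@spoint_opp n)
  (fun c x => if c then g (t0 (g^-1%g x)) else t0 x)
  (fun c x => if c then g^-1%g x \in P0 else x \in P0).

Lemma matching_pair_axioms g : g \in B n -> bimatch_axioms (matching_pair g).
Proof.
move=> gB; have /in_B gO := gB; have /in_B gVO := groupVr gB.
have [o neq m mo no f p] := base_axioms le_kn.
have gI (x y : V) : (g x == y) = (x == g^-1%g y) by rewrite -[RHS](inj_eq (@perm_inj _ g)) permKV.
split=> [||[] x|[] x|[] x|[] x|[] x] //.
- by rewrite /= permK -[RHS](permKV g); congr (g _); apply: (m true).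
- exact: (m false).
- by rewrite /= gVO -gO; congr (g _); apply: (mo true).
- exact: (mo false).
- by rewrite /= gI gVO; apply: (no true (g^-1%g x)).
- exact: (no false).
- by rewrite /= gI gVO; apply: (f true (g^-1%g x)).
- exact: (f false).
- by rewrite /= gVO; apply: (p true (g^-1%g x)).
exact: (p false).
Qed.

(** The permutation F given by f preserves the base matching, and so does [g * F * g'^-1], because F
    carries the second matching of g to that of g'. *)
Lemma embedding_dcoset g g' f : g \in B n -> g' \in B n ->
  embedding (matching_pair g) (matching_pair g') f -> g' \in dcoset H g.
Proof.
move=> gB g'B [f_inj f_opp f_mate f_pos]; pose F := perm f_inj.
have FE x : F x = f x by rewrite permE.
have FB : F \in B n by apply/in_B=> x; rewrite !FE; apply: f_opp.
have FH : F \in H.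
  apply/HkP; split=> // x; rewrite !FE; first exact: (f_mate false).
  exact: (f_pos false).
have uH : (g * F * g'^-1)%g \in H.
  apply/HkP; split=> [|x|x]; first by rewrite !groupM ?groupV.
    rewrite !permM !FE; have := f_mate true (g x); rewrite /= permK => ->.
    by rewrite permK.
  by rewrite !permM !FE; have := f_pos true (g x); rewrite /= permK.
apply/dcosetP; exists (g * F * g'^-1)^-1%g; rewrite ?groupV //; exists F => //.
by rewrite !invMg invgK -!mulgA mulKg mulVg mulg1.
Qed.

Lemma dcoset_embedding g g' : g' \in dcoset H g ->
  exists f, embedding (matching_pair g) (matching_pair g') f.
Proof.
case/dcosetP=> h hH [u uH ->]; exists u.
have [[/in_B hO hC hP] [/in_B uO uC uP]] := (HkP _ hH, HkP _ uH).
have /HkP[_ hVC hVP] := groupVr hH.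
split=> [|x|[] x|[] x]; rewrite /= ?uO ?uC ?uP //; first exact: perm_inj.
  by rewrite !invMg !permM permK hC permKV.
by rewrite !invMg !permM permK hVP.
Qed.

(** Transporting [std_swap] gives an involution w exchanging the base matching with its image under
    g; then [w * g^-1] preserves the base matching. *)
Lemma swapped_pair l f g : g \in B n -> #|std_type l| = #|V| ->
  embedding (std l) (matching_pair g) f ->
  exists2 h, h \in H & (h * g * (h * g) = 1)%g.
Proof.
move=> gB cardV femb.
have [f' fK [f'K f'emb]] := embedding_bij femb (eq_leq (esym cardV)).
have w_inj : injective (fun x => f (std_swap (f' x))).
  by apply: (inj_comp (emb_inj femb)); apply: inj_comp (emb_inj f'emb); apply: inv_inj (@std_swapK l).
pose w := perm w_inj; have wE x : w x = f (std_swap (f' x)) by rewrite permE.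
have ww : (w * w = 1)%g by apply/permP=> x; rewrite permM perm1 !wE fK std_swapK f'K.
have wmate c x : mate (matching_pair g) c (w x) = w (mate (matching_pair g) (~~ c) x).
  by rewrite !wE -(emb_mate femb) std_swap_mate (emb_mate f'emb).
have wpos c x : pos (matching_pair g) c (w x) = pos (matching_pair g) (~~ c) x.
  by rewrite wE (emb_pos femb) std_swap_pos (emb_pos f'emb).
have wB : w \in B n.
  apply/in_B=> x; rewrite !wE -[spoint_opp x]/(opp (matching_pair g) x).
  by rewrite (emb_opp f'emb) std_swap_opp (emb_opp femb).
exists (w * g^-1)%g; last by rewrite mulgKV ww.
apply/HkP; split=> [|x|x]; first by rewrite groupM ?groupV.
  rewrite !permM; have := wmate true x; rewrite /= => <-.
  by rewrite permK.
by rewrite permM; apply: (wpos true x).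
Qed.

(** By [doubled_iso] each matching of [std l] can be identified with the base one, the numbers of
    points and of unmatched points being equal; g compares the two identifications. *)
Lemma std_matching_pair l : all (fun p => 0 < p.1) l ->
  sumn [seq p.1 | p <- l] = n -> count (fun p => odd p.1) l = n - 2 * k ->
  exists2 g, g \in B n & exists f, embedding (std l) (matching_pair g) f.
Proof.
move=> l_gt0 sum_l odd_l.
have cardV : #|std_type l| = #|V|.
  by rewrite card_std_type sum_l card_prod card_ord card_bool mulnC.
have iso c : exists f, embedding (doubled (std l) c) (base le_kn) f.
  have [|f femb] := @doubled_iso _ _ (std l) (base le_kn) c false (std_axioms l)
    (base_axioms le_kn) cardV; last by exists f.
  by rewrite card_std_pos card_std_pos_odd // odd_l -(card_base_pos le_kn).
have [[f0 emb0] [f1 emb1]] := (iso false, iso true).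
have [f1' f1K [f1'K emb1']] := embedding_bij emb1 (eq_leq (esym cardV)).
have g_inj : injective (f0 \o f1') := inj_comp (emb_inj emb0) (emb_inj emb1').
pose g := perm g_inj; have gE x : g x = f0 (f1' x) by rewrite permE.
have gVf0 z : g^-1%g (f0 z) = f1 z.
  by apply: (@perm_inj _ g); rewrite permKV gE f1K.
exists g.
  apply/in_B=> x; rewrite !gE -[spoint_opp x]/(opp (base le_kn) x).
  by rewrite (emb_opp emb1') /= (emb_opp emb0).
exists f0; split=> [||[] z|[] z].
- exact: emb_inj emb0.
- exact: emb_opp emb0.
- rewrite /= gVf0 gE; congr f0; rewrite -[LHS]f1K; congr (f1' _).
  exact: (emb_mate emb1 true).
- exact: (emb_mate emb0 false).
- by rewrite /= gVf0; apply: (emb_pos emb1 true).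
exact: (emb_pos emb0 false).
Qed.

(** The half-turn s of a bad path lies in H and acts on [base_pos] as one transposition, while its
    conjugate by g^-1 lies in H and acts there trivially: the signs differ. *)
Lemma admissible_good g : g \in B n -> admissible lam g -> good (matching_pair g).
Proof.
move=> gB /admissibleP adm x i px fix_i; apply/eqP/negPn/negP=> /eqP neq_i.
have wf := matching_pair_axioms gB.
rewrite walk_double in fix_i neq_i.
have [f femb [y [neq_yx py fx fy [f_fix0 f_fix1]]]] := half_turn wf px fix_i neq_i.
have [f_inj f_opp f_mate f_pos] := femb.
pose s := perm f_inj; have sE z : s z = f z by rewrite permE.
have sH : s \in H.
  apply/HkP; split=> [|z|z]; first by apply/in_B=> z; rewrite !sE; apply: f_opp.
    by rewrite !sE; apply: (f_mate false).
  by rewrite sE; apply: (f_pos false).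
have hH : (s ^ g^-1)%g \in H.
  apply/HkP; split=> [|z|z]; first by rewrite groupJ ?groupV //; case/HkP: sH.
    rewrite conjgE invgK !permM !sE; have := f_mate true (g z); rewrite /= permK => ->.
    by rewrite permK.
  by rewrite conjgE invgK !permM sE; have := f_pos true (g z); rewrite /= permK.
have NP w : w \in H -> w \in ('N(P0 | 'P))%g.
  by case/HkP=> _ _ wP; apply/astabsP.
have := adm _ hH; rewrite -conjgM mulVg conjg1 => /(_ sH).
rewrite !lambdakE //.
have -> : restr_perm P0 s = tperm x y.
  apply/permP=> z; have [zP|zP] := boolP (z \in P0).
    rewrite (restr_permE (NP _ sH) zP) sE; case: tpermP => [->|->|/eqP zx /eqP zy] //.
    exact: f_fix0.
  rewrite (out_perm (restr_perm_on P0 _) zP) tpermD //; apply: contraNneq zP => <- //.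
have -> : restr_perm P0 (s ^ g^-1)%g = 1%g.
  apply/permP=> z; rewrite perm1; have [zP|zP] := boolP (z \in P0).
    rewrite (restr_permE (NP _ hH) zP) conjgE invgK !permM sE f_fix1 ?permK //.
    by rewrite /= permK.
  exact: (out_perm (restr_perm_on P0 _) zP).
rewrite odd_tperm odd_perm1 eq_sym neq_yx expr1 expr0 => /eqP.
by rewrite eq_sym -subr_eq0 opprK (pnatr_eq0 _ 2).
Qed.

(** [far_end] matches the positive unmatched points of both matchings compatibly with automorphisms;
    through it the actions of h and [h ^ g] on [base_pos] are conjugate, hence of equal sign. *)
Lemma good_admissible g : g \in B n -> good (matching_pair g) -> admissible lam g.
Proof.
move=> gB gS; have wf := matching_pair_axioms gB.
apply/admissibleP=> h hH kH; set u := (h ^ g)%g in kH *.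
have hE x : h x = g^-1%g (u (g x)) by rewrite /u conjgE !permM !permK.
have [/in_B hO hC hP] := HkP _ hH; have [/in_B uO uC uP] := HkP _ kH.
have uemb : embedding (matching_pair g) (matching_pair g) u.
  split=> [|x|[] x|[] x] //=; first exact: perm_inj.
    by rewrite /u conjgE !permM !permK hC.
  by rewrite /u conjgE !permM !permK hP.
pose psi x := if x \in P0 then g^-1%g (far_end (matching_pair g) x) else x.
have psiP x : x \in P0 -> psi x \in P0.
  by rewrite /psi => xP; rewrite xP; apply: (far_end_pos wf gS).
have psi_id x : x \notin P0 -> psi x = x by rewrite /psi => /negbTE->.
have psi_inj : injective psi.
  move=> x y; have [[xP|xP] [yP|yP]] := (boolP (x \in P0), boolP (y \in P0)).
  - rewrite /psi xP yP => /perm_inj; exact: (far_end_inj wf xP yP).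
  - by rewrite (psi_id y) // => eq_xy; case/negP: yP; rewrite -eq_xy psiP.
  - by rewrite (psi_id x) // => eq_xy; case/negP: xP; rewrite eq_xy psiP.
  by rewrite !psi_id.
have NP w : w \in H -> w \in ('N(P0 | 'P))%g.
  by case/HkP=> _ _ wP; apply/astabsP.
rewrite !lambdakE //; congr (_ ^+ nat_of_bool _)%R.
rewrite -(odd_permJ _ (perm psi_inj)); congr odd_perm.
apply/permP=> y; rewrite -[y in LHS](permKV (perm psi_inj)) -[y in RHS](permKV (perm psi_inj)).
move: ((perm psi_inj)^-1%g y) => x; have psiE := permE psi_inj; rewrite permJ !psiE.
have [xP|xP] := boolP (x \in P0).
  rewrite (restr_permE (NP _ kH) xP) (restr_permE (NP _ hH) (psiP _ xP)).
  rewrite /psi uP xP hE permKV; congr (g^-1%g _).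
  exact: far_end_emb.
rewrite (psi_id x) // (out_perm (restr_perm_on P0 _) xP) psi_id //.
by rewrite (out_perm (restr_perm_on P0 _) xP).
Qed.

End PairsOfMatchings.

(** * Block lists as pairs of partitions, and the count of double cosets *)

Definition signed_parts (a b : seq nat) : seq (nat * bool) :=
  [seq (m, false) | m <- a] ++ [seq (m, true) | m <- b].

Lemma signed_parts_gt0 a b : is_part a -> is_part b ->
  all (fun p => 0 < p.1) (signed_parts a b).
Proof.
case/andP=> _ a0 /andP[_ b0]; rewrite all_cat !all_map.
by apply/andP; split; apply/allP=> m /=; rewrite lt0n; apply: contraTneq => ->.
Qed.

Lemma sumn_signed_parts a b : sumn [seq p.1 | p <- signed_parts a b] = sumn a + sumn b.
Proof. by rewrite map_cat sumn_cat -!map_comp !map_id. Qed.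

Lemma count_signed_parts a b :
  count (fun p => odd p.1) (signed_parts a b) = odd_parts a + odd_parts b.
Proof. by rewrite count_cat !count_map. Qed.

Definition sign_class (l : seq (nat * bool)) (b : bool) : seq nat :=
  [seq p.1 | p <- l & p.2 == b].

Lemma sign_class_signed_parts a b c :
  sign_class (signed_parts a b) c = if c then b else a.
Proof.
rewrite /sign_class filter_cat !filter_map map_cat -!map_comp /preim /=.
by case: c; rewrite ?filter_pred0 ?filter_predT /= map_id ?cats0.
Qed.

Lemma signed_parts_inj a b a' b' :
  is_part a -> is_part b -> is_part a' -> is_part b' ->
  perm_eq (signed_parts a b) (signed_parts a' b') -> a = a' /\ b = b'.
Proof.
move=> /andP[sa _] /andP[sb _] /andP[sa' _] /andP[sb' _] eq_l.
have geq_trans : transitive geq by move=> x y z xy yz; apply: leq_trans yz xy.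
have geq_anti : antisymmetric geq by move=> x y /andP[xy yx]; apply/eqP; rewrite eqn_leq; apply/andP.
have eq_class c : perm_eq (sign_class (signed_parts a b) c) (sign_class (signed_parts a' b') c).
  by apply: perm_map; apply: perm_filter.
split; apply: (sorted_eq geq_trans geq_anti) => //.
  by have := eq_class false; rewrite !sign_class_signed_parts.
by have := eq_class true; rewrite !sign_class_signed_parts.
Qed.

Lemma perm_signed_parts l : all (fun p => 0 < p.1) l ->
  exists a b, [/\ is_part a, is_part b & perm_eq l (signed_parts a b)].
Proof.
move=> l_gt0; exists (sort geq (sign_class l false)), (sort geq (sign_class l true)).
have part c : is_part (sort geq (sign_class l c)).
  apply/andP; split; first by apply: sort_sorted => x y; apply: leq_total.
  rewrite mem_sort; apply/mapP=> -[p]; rewrite mem_filter => /andP[_ /(allP l_gt0)].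
  by move=> /[swap] <-.
split=> //; rewrite perm_sym.
have class_cat : perm_eq (signed_parts (sign_class l false) (sign_class l true)) l.
  rewrite /signed_parts /sign_class -!map_comp.
  have eq_id c : [seq (p.1, c) | p <- l & p.2 == c] = [seq p <- l | p.2 == c].
    rewrite -[RHS]map_id; apply/eq_in_map => -[m s]; rewrite mem_filter => /andP[/eqP/= ->].
    by [].
  rewrite [X in X ++ _](eq_id false) [X in _ ++ X](eq_id true).
  rewrite [X in _ ++ X](eq_filter (a2 := predC (fun p => p.2 == false))); last by case=> m [].
  exact/permEl/perm_filterC.
apply: perm_trans class_cat; apply: perm_cat; apply: perm_map; exact/permEl/perm_sort.
Qed.

Lemma parts_inj N : injective (@parts N).
Proof.
move=> s t; rewrite /parts => /(inj_map val_inj) eq_st; exact: val_inj.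
Qed.

Section DoubleCosetCount.
Variables (n k q : nat).
Hypothesis nE : n = 2 * k + q.
Let le_kn : 2 * k <= n. Proof. by rewrite nE leq_addr. Qed.
Local Notation H := (Hk n k).
Local Notation lam := (lambdak n k).

Let biparts := [set ab : bseqN n * bseqN n |
      [&& is_part (parts ab.1), is_part (parts ab.2),
          sumn (parts ab.1) + sumn (parts ab.2) == n
        & odd_parts (parts ab.1) + odd_parts (parts ab.2) == q]].
Let blocks_of (ab : bseqN n * bseqN n) := signed_parts (parts ab.1) (parts ab.2).

Let biparts_gt0 ab : ab \in biparts -> all (fun p => 0 < p.1) (blocks_of ab).
Proof. by rewrite inE => /and4P[pa pb _ _]; apply: signed_parts_gt0. Qed.

Let card_blocks ab : ab \in biparts -> #|std_type (blocks_of ab)| = #|{: spoint n}|.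
Proof.
rewrite inE => /and4P[_ _ /eqP sum_ab _].
by rewrite card_std_type sumn_signed_parts sum_ab card_prod card_ord card_bool mulnC.
Qed.

Lemma admissible_blocks g : g \in B n -> admissible lam g ->
  exists2 ab, ab \in biparts & exists f, embedding (std (blocks_of ab)) (matching_pair le_kn g) f.
Proof.
move=> gB /(admissible_good (le_kn := le_kn) gB) gS.
have wf := matching_pair_axioms le_kn gB.
have eq_pos : #|pos (matching_pair le_kn g) false| = #|pos (matching_pair le_kn g) true|.
  rewrite -(card_image (@perm_inj _ g)); apply: eq_card => x.
  by rewrite -[x in LHS](permKV g) mem_image; last exact: perm_inj.
have [l [/typed_gt0 l_gt0 cardV [f femb]]] := classification wf gS eq_pos.
have [a [b [pa pb eq_l]]] := perm_signed_parts l_gt0.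
have sum_ab : sumn a + sumn b = n.
  apply/eqP; rewrite -sumn_signed_parts -(perm_sumn (perm_map fst eq_l)).
  rewrite -(eqn_pmul2l (isT : 0 < 2)) -card_std_type cardV.
  by rewrite card_prod card_ord card_bool mulnC.
have [f' fK [f'K f'emb]] := embedding_bij femb (eq_leq (esym cardV)).
have odd_ab : odd_parts a + odd_parts b = q.
  rewrite -count_signed_parts -(seq.permP eq_l) -card_std_pos_odd //.
  have <- : #|base_pos n k| = q by rewrite card_base_pos // nE; lia.
  rewrite -(card_image (emb_inj femb)); apply: eq_card => x.
  rewrite -[x in LHS]f'K mem_image; last exact: emb_inj femb.
  by have := emb_pos f'emb false x; rewrite /= => <-.
have [|ta eq_a] := partsP (N := n) pa; first by rewrite -sum_ab leq_addr.
have [|tb eq_b] := partsP (N := n) pb; first by rewrite -sum_ab leq_addl.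
exists (ta, tb); first by rewrite inE /= eq_a eq_b pa pb sum_ab odd_ab !eqxx.
rewrite /blocks_of /= eq_a eq_b; have [h hemb] := std_perm l_gt0 eq_l.
by exists (f \o h); apply: embedding_comp hemb femb.
Qed.

Lemma cfnorm_Ind_lambdak : ('['Ind[B n] lam] = (num_bipart n q)%:R)%R.
Proof.
(* The implication makes the choice total; outside [biparts] the value 1 is arbitrary. *)
have rep ab : exists g, ab \in biparts ->
    g \in B n /\ exists f, embedding (std (blocks_of ab)) (matching_pair le_kn g) f.
  have [abA|_] := boolP (ab \in biparts); last by exists 1%g.
  have := abA; rewrite inE => /and4P[pa pb /eqP sum_ab /eqP odd_ab].
  have [||g gB [f femb]] := std_matching_pair le_kn (biparts_gt0 abA).
  - by rewrite sumn_signed_parts.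
  - by rewrite count_signed_parts odd_ab nE addKn.
  by exists g => _; split=> //; exists f.
have [w wP] := fin_all_exists rep.
apply: (@cfnorm_Ind_card _ (B n) H lam (lambdak_lin n k) (Hk_sub_B le_kn) _ biparts w).
- by move=> ab /wP[].
- move=> ab /[dup] abA /wP[gB [f femb]]; apply: (good_admissible (le_kn := le_kn) gB).
  have [f' _ [_ f'emb]] := embedding_bij femb (eq_leq (esym (card_blocks abA))).
  exact: (good_emb f'emb (@good_std _)).
- move=> g gB /(admissible_blocks gB)[ab abA [f femb]]; exists ab => //.
  have [wB [f0 emb0]] := wP _ abA.
  have [f0' _ [_ emb0']] := embedding_bij emb0 (eq_leq (esym (card_blocks abA))).
  exact: embedding_dcoset wB gB (embedding_comp emb0' femb).
move=> ab ab' abA ab'A /(dcoset_embedding le_kn)[f femb].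
have [[wB [f0 emb0]] [w'B [f1 emb1]]] := (wP _ abA, wP _ ab'A).
have [f1' _ [_ emb1']] := embedding_bij emb1 (eq_leq (esym (card_blocks ab'A))).
have eq_l := std_iso_perm (biparts_gt0 abA) (biparts_gt0 ab'A)
  (embedding_comp (embedding_comp emb0 femb) emb1')
  (eq_leq (etrans (card_blocks ab'A) (esym (card_blocks abA)))).
move: abA ab'A; rewrite !inE => /and4P[pa pb _ _] /and4P[pa' pb' _ _].
have [/parts_inj eq1 /parts_inj eq2] := signed_parts_inj pa pb pa' pb' eq_l.
by rewrite [ab]surjective_pairing eq1 eq2 -surjective_pairing.
Qed.

Theorem lambdak_gelfand (C : numClosedFieldType) (iota : {rmorphism algC -> C}) :
  linear_gelfand_triple (B n) lam /\ hecke_iso_pow iota (B n) lam (num_bipart n q).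
Proof.
apply: (gelfand_count (Hk_sub_B le_kn) (lambdak_lin n k) (lambdak_real le_kn) _ iota cfnorm_Ind_lambdak).
move=> g gB adm; have [ab abA [f femb]] := admissible_blocks gB adm.
exact: swapped_pair gB (card_blocks abA) femb.
Qed.

End DoubleCosetCount.

(** * Pairs of partitions without odd parts *)

Section EvenBipartitions.

(** The two sets live in types with different bounds, so they are compared through their underlying
    sequences. *)
Lemma card_parts_le N N' (A : {set bseqN N}) (A' : {set bseqN N'}) (f : seq nat -> seq nat) :
  {in A &, forall a b, f (parts a) = f (parts b) -> parts a = parts b} ->
  {in A, forall a, exists2 b, b \in A' & parts b = f (parts a)} -> #|A| <= #|A'|.
Proof.
move=> f_inj f_ex; rewrite !cardE -(size_map (fun a => f (parts a))) -(size_map (@parts N')).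
apply: uniq_leq_size.
  rewrite map_inj_in_uniq ?enum_uniq // => a b; rewrite !mem_enum => aA bA.
  by move/f_inj => /(_ aA bA)/parts_inj.
move=> s /mapP[a]; rewrite mem_enum => /f_ex[b bA' <-] ->.
by apply: map_f; rewrite mem_enum.
Qed.

Definition even_parts (N i : nat) : {set bseqN N} :=
  [set s | [&& is_part (parts s), sumn (parts s) == 2 * i & odd_parts (parts s) == 0]].

Lemma odd_parts0 s : (odd_parts s == 0) = all (fun m => ~~ odd m) s.
Proof. by rewrite /odd_parts all_predC has_count -leqNgt leqn0. Qed.

Lemma map_half_double s : odd_parts s = 0 -> map double (map half s) = s.
Proof.
move/eqP; rewrite odd_parts0 => /allP ev; rewrite -map_comp -[RHS]map_id.
by apply/eq_in_map => m /ev /=; lia.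
Qed.

Lemma is_part_double s : is_part (map double s) = is_part s.
Proof.
rewrite /is_part sorted_map; congr (_ && ~~ _).
  by apply: eq_sorted => x y /=; rewrite leq_double.
by rewrite -[0]double0 (mem_map double_inj).
Qed.

Lemma sumn_double s : sumn (map double s) = 2 * sumn s.
Proof. by elim: s => //= m s ->; lia. Qed.

Lemma odd_parts_double s : odd_parts (map double s) = 0.
Proof. by apply/eqP; rewrite odd_parts0 all_map; apply/allP=> m _ /=; rewrite odd_double. Qed.

Lemma card_even_parts N i : 2 * i <= N -> #|even_parts N i| = num_part i.
Proof.
move=> le_iN; apply/eqP; rewrite eqn_leq; apply/andP; split.
  apply: (card_parts_le (f := map half)) => [a b | a].
    rewrite !inE => /and3P[_ _ /eqP ev_a] /and3P[_ _ /eqP ev_b].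
    by move/(congr1 (map double)); rewrite !map_half_double.
  rewrite inE => /and3P[pa /eqP sa /eqP ev_a]; rewrite -(map_half_double ev_a) in pa sa.
  rewrite is_part_double in pa; rewrite sumn_double in sa.
  have sum_i : sumn (map half (parts a)) = i by lia.
  have [|b eq_b] := partsP (N := i) pa; first by rewrite sum_i.
  by exists b; rewrite // inE eq_b pa sum_i eqxx.
apply: (card_parts_le (f := map double)) => [a b _ _ | a].
  exact: (inj_map double_inj).
rewrite inE => /andP[pa /eqP sa].
have [||b eq_b] := partsP (N := N) (s := map double (parts a)).
- by rewrite is_part_double.
- by rewrite sumn_double sa.
by exists b; rewrite // inE eq_b is_part_double pa sumn_double sa odd_parts_double !eqxx.
Qed.

(** Without odd parts, halving every part leaves an arbitrary pair of partitions of total size k,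
    sorted by the size i of the first. *)
Lemma num_bipart_even k :
  num_bipart (2 * k) 0 = \sum_(0 <= i < k.+1) num_part i * num_part (k - i).
Proof.
rewrite big_mkord /num_bipart -sum1_card.
rewrite (partition_big (fun ab : bseqN (2 * k) * bseqN (2 * k) =>
  inord (sumn (parts ab.1))./2 : 'I_k.+1) predT) //=.
apply: eq_bigr => i _; have le_ik : i <= k by rewrite -ltnS.
rewrite sum1_card -(card_even_parts (N := 2 * k)) ?leq_mul2l //.
rewrite -(card_even_parts (N := 2 * k)) ?leq_mul2l ?leq_subr // -cardsX.
have even_sum s : odd_parts s = 0 -> sumn s = 2 * (sumn s)./2.
  by move/map_half_double=> <-; rewrite sumn_double; lia.
apply: eq_card => -[a b]; rewrite in_setX !inE -topredE /= !inE /= addn_eq0.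
apply/andP/andP => [[/and4P[pa pb /eqP sum_ab /andP[ev_a ev_b]] /eqP eq_i] |
    [/and3P[pa /eqP sum_a ev_a] /and3P[pb /eqP sum_b ev_b]]].
  have := congr1 val eq_i; rewrite /= inordK => [half_i|]; last by lia.
  have := even_sum _ (eqP ev_a); rewrite half_i => sum_a.
  have sum_b : sumn (parts b) = 2 * (k - i) by lia.
  by rewrite pa pb ev_a ev_b sum_a sum_b !eqxx.
rewrite pa pb ev_a ev_b sum_a sum_b; split; first by rewrite /= andbT; lia.
by rewrite mul2n doubleK; apply/eqP/val_inj; rewrite /= inordK.
Qed.

End EvenBipartitions.

Section Transfer.
Variables (gT : finGroupType) (G H K : {group gT}) (lam : 'CF(H)) (mu : 'CF(K)).
Hypotheses (eqHK : H = K) (eq_lam : lam =1 mu).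

Lemma linear_gelfand_triple_eq : linear_gelfand_triple G lam -> linear_gelfand_triple G mu.
Proof. by move: mu eq_lam; case: K / eqHK => mu' /cfunP->. Qed.

Lemma hecke_iso_pow_eq (C : numClosedFieldType) (iota : {rmorphism algC -> C}) b :
  hecke_iso_pow iota G lam b -> hecke_iso_pow iota G mu b.
Proof. by move: mu eq_lam; case: K / eqHK => mu' /cfunP->. Qed.

End Transfer.

(** For q = 0 the tail group is trivial and no point is unmatched, so H is [Ck] and the sign is the
    trivial character. *)
Lemma even_gelfand k (C : numClosedFieldType) (iota : {rmorphism algC -> C}) :
  gelfand_pair (B (2 * k)) (Ck (2 * k) k) /\
  hecke_iso_pow iota (B (2 * k)) (1%R : 'CF(Ck (2 * k) k))
    (\sum_(0 <= i < k.+1) num_part i * num_part (k - i)).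
Proof.
have [] := @lambdak_gelfand (2 * k) k 0 (esym (addn0 _)) C iota.
rewrite num_bipart_even.
have P0_empty : base_pos (2 * k) k = set0.
  by apply/setP=> -[i b]; rewrite !inE /= leqNgt ltn_ord.
have Stail1 : Stail (2 * k) (2 * k) = 1%G.
  apply/trivGP/subsetP=> _ /morphimP[s _ Ss ->]; rewrite inE in Ss.
  have -> : s = 1%g; last by rewrite morph1 ?inE.
  apply/permP=> i; rewrite perm1; apply: (out_perm Ss).
  by rewrite inE -ltnNge ltn_ord.
have eqH : Hk (2 * k) k = Ck (2 * k) k by rewrite /Hk Stail1; apply: val_inj; rewrite /= joingG1.
have eq_lam : lambdak (2 * k) k =1 (1%R : 'CF(Ck (2 * k) k)).
  move=> h; rewrite cfun1E -eqH; have [hH|hH] := boolP (h \in Hk _ _); last by rewrite cfun0.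
  rewrite lambdakE // P0_empty; have -> : restr_perm set0 h = 1%g; last by rewrite odd_perm1.
  by apply/permP=> x; rewrite perm1 (out_perm (restr_perm_on set0 h)) // inE.
move=> /(linear_gelfand_triple_eq eqH eq_lam) gelf /(hecke_iso_pow_eq eqH eq_lam) iso.
by split.
Qed.

(** * The characters U_n and their twists by the sign-change character *)

Local Open Scope ring_scope.

(** By Frobenius reciprocity mu occurs once in the character induced from H to K; its other
    constituents can only increase multiplicities in G. *)
Lemma multiplicity_free_extend (gT : finGroupType) (G K H : {group gT}) (mu : 'CF(K)) :
  H \subset K -> K \subset G -> mu \is a linear_char ->
  multiplicity_free ('Ind[G] ('Res[H] mu)) -> multiplicity_free ('Ind[G] mu).
Proof.
move=> sHK sKG mu_lin mf i; apply: Order.POrderTheory.le_trans (mf i).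
have lam_lin : 'Res[H] mu \is a linear_char by apply: cfRes_lin_char.
rewrite -(cfIndInd _ sKG sHK) -[leLHS]Frobenius_reciprocity -[leRHS]Frobenius_reciprocity.
have Nchi : 'Res[K] 'chi_i \is a character by rewrite cfRes_char ?irr_char.
have Nind : 'Ind[K] ('Res[H] mu) \is a character by rewrite cfInd_char ?lin_charW.
have /irrP[j mu_j] := lin_char_irr mu_lin.
have ind_j : '['Ind[K] ('Res[H] mu), 'chi_j] = 1.
  rewrite -mu_j -Frobenius_reciprocity; have /irrP[l ->] := lin_char_irr lam_lin.
  exact: cfnorm_irr.
have -> : '[mu, 'Res[K] 'chi_i] = '['Res[K] 'chi_i, 'chi_j].
  by rewrite mu_j cfdotC_char ?irr_char.
rewrite [leRHS](cfdot_sum_irr ('Ind[K] _)) (bigD1 j) //= ind_j mul1r.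
rewrite (conj_natr (Cnat_cfdot_char_irr j Nchi)) lerDl sumr_ge0 // => l _.
by rewrite mulr_ge0 ?conjC_ge0 ?natr_ge0 // Cnat_cfdot_char_irr.
Qed.

Lemma multiplicity_free_mul_lin (gT : finGroupType) (G : {group gT}) (eps phi : 'CF(G)) :
  eps \is a linear_char -> {in G, forall x, (eps x)^* = eps x} ->
  multiplicity_free phi -> multiplicity_free (eps * phi).
Proof.
move=> eps_lin eps_real mf i.
have /irrP[j eq_j] := mul_lin_irr eps_lin (mem_irr i).
suffices -> : '[eps * phi, 'chi_i] = '[phi, 'chi_j] by apply: mf.
rewrite -eq_j !cfdotE; congr (_ * _); apply: eq_bigr => x xG.
by rewrite !cfunE rmorphM /= eps_real // mulrA [phi x * _]mulrC.
Qed.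

Fact eps_repr n : mx_repr (B n) (fun w => ((-1) ^+ neg_count w)%:M : 'M[algC]_1).
Proof.
split=> [|u v uB vB].
  by rewrite /neg_count eq_card0 // => i; rewrite inE perm1.
by rewrite -scalar_mxM -signr_odd neg_countM // signr_addb !signr_odd.
Qed.

Lemma cfeps_lin n : cfeps n \is a linear_char.
Proof.
have -> : cfeps n = cfRepr (MxRepresentation (eps_repr n)).
  by apply/cfun_inP=> w wB; rewrite !cfunE wB /= mxtrace_scalar.
by rewrite qualifE /= cfRepr_char cfRepr1 eqxx.
Qed.

Lemma cfeps_real n : {in B n, forall w, (cfeps n w)^* = cfeps n w}.
Proof. by move=> w wB; rewrite cfunE wB mulr1n rmorphXn rmorphN1. Qed.

Section BTwo.
Variable n : nat.
Hypothesis n_ge2 : (2 <= n)%N.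

Lemma B2S_sub_B : B2S n \subset B n.
Proof.
rewrite join_subG subsetIl; apply: subset_trans (Stail_sub_stab (k := 1) n_ge2) _.
by apply/subsetP=> w /stabP[].
Qed.

Lemma Ck_sub_Bhead : Ck n 1 \subset Bhead n 2.
Proof.
apply/subsetP=> w wC; apply/setIP; split.
  by have /stabP[] := subsetP (Ck_sub_stab (k := 1) n_ge2) _ wC.
have := subsetP (Ck_sub_Sym n 1) _ wC; rewrite inE => Sw.
by apply/astabP=> x; rewrite inE => le_x; apply: (out_perm Sw); rewrite inE -leqNgt.
Qed.

Lemma Hk_sub_B2S : Hk n 1 \subset B2S n.
Proof. exact: genS (setSU _ Ck_sub_Bhead). Qed.

Lemma lambda2_lin : lambda2 n \is a linear_char.
Proof. exact: cfDprod_lin_char (cfun1_lin_char _) (cfsgn_tail_lin _ _). Qed.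

Lemma Res_lambda2 : 'Res[Hk n 1] (lambda2 n) = lambdak n 1.
Proof.
apply/cfun_inP=> h hH; rewrite cfResE ?Hk_sub_B2S //.
have [_ mulH _ _] := dprodP (Hk_dprod n 1).
have : h \in (Ck n 1 * Stail n (2 * 1))%g by rewrite mulH.
case/mulsgP=> c s cC sS ->.
have cB := subsetP Ck_sub_Bhead _ cC.
by rewrite /lambda2 /lambdak (cfDprodE _ _ _ cB sS) (cfDprodE _ _ _ cC sS) !cfun1E cB cC.
Qed.

Lemma U_multiplicity_free : multiplicity_free (U n).
Proof.
apply: (multiplicity_free_extend Hk_sub_B2S B2S_sub_B lambda2_lin).
have nE : n = (2 * 1 + (n - 2))%N by rewrite muln1 subnKC.
rewrite Res_lambda2; have [[_ _ mf] _] := lambdak_gelfand nE (idfun : {rmorphism algC -> algC}).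
exact: mf.
Qed.

End BTwo.

Theorem corollary4p2 (C : numClosedFieldType) (iota : {rmorphism algC -> C}) :
  [/\ forall n k q : nat, n = (2 * k + q)%N -> (2 <= n)%N ->
        linear_gelfand_triple (B n) (lambdak n k) /\
        hecke_iso_pow iota (B n) (lambdak n k) (num_bipart n q),
      forall k : nat, (2 <= 2 * k)%N ->
        gelfand_pair (B (2 * k)) (Ck (2 * k) k) /\
        hecke_iso_pow iota (B (2 * k)) (1 : 'CF(Ck (2 * k) k))
          (\sum_(0 <= i < k.+1) num_part i * num_part (k - i))%N
    & forall n : nat, (2 <= n)%N ->
        [/\ linear_gelfand_triple (B n) (lambda2 n),
            linear_gelfand_triple (B n) ('Res[B2S n] (cfeps n) * lambda2 n),
            multiplicity_free (U n)
          & multiplicity_free (cfeps n * U n)]].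
Proof.
split=> [n k q nE _ | k _ | n n_ge2]; first exact: lambdak_gelfand.
  exact: even_gelfand.
have [sBB mfU] := (B2S_sub_B n_ge2, U_multiplicity_free n_ge2).
have mf_epsU : multiplicity_free (cfeps n * U n).
  exact: multiplicity_free_mul_lin (cfeps_lin n) (@cfeps_real n) mfU.
split=> //; split=> //; first exact: lambda2_lin.
  by rewrite rpredM ?cfRes_lin_char ?cfeps_lin ?lambda2_lin.
(* Projection formula: the twist of [U n] is induced from the twist of [lambda2 n]. *)
by rewrite mulrC cfIndM // mulrC.
Qed.
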